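(* Let $d\ge 1$, $\alpha>1$, let $\{\gamma_{\mathfrak u}\}_{\mathfrak u\subset\mathbb N,\,|\mathfrak u|<\infty}$ be nonnegative weights with $\gamma_\emptyset=1$, let $n$ be prime and $M>0$. Let $\boldsymbol z\in\{1,\ldots,n-1\}^d$ be a generating vector obtained from the component-by-component (CBC) construction (defined in the context) for these $n$, $d$, $\alpha$ and weights, and consider the lattice algorithm $A$ with index set $\mathcal A_d(M)$ and generating vector $\boldsymbol z$. Then for all $\lambda\in(\frac1\alpha,1]$, with $\tau:=\max(6,\,2.5+2^{2\alpha\lambda+1})$, $$e^{\rm wor\text{-}app}_{n,d,M}(\boldsymbol z)\le\Big(\frac1M+M\,S_d(\boldsymbol z)\Big)^{1/2}\le\Bigg(\frac1M+M\bigg[\frac{\tau}{n}\bigg(\sum_{\emptyset\ne\mathfrak u\subseteq\{1,\ldots,d\}}|\mathfrak u|\,\gamma_{\mathfrak u}^\lambda\,[2\zeta(\alpha\lambda)]^{|\mathfrak u|}\bigg)\bigg(\sum_{\mathfrak u\subseteq\{1,\ldots,d\}}\gamma_{\mathfrak u}^\lambda\,[2\zeta(\alpha\lambda)]^{|\mathfrak u|}\bigg)\bigg]^{1/\lambda}\Bigg)^{1/2}.$$ Taking $M=n^{1/(2\lambda)}$, we obtain $$e^{\rm wor\text{-}app}_{n,d,M}(\boldsymbol z)\le\frac{\sqrt2\,\tau^{1/(2\lambda)}}{n^{1/(4\lambda)}}\bigg(\sum_{\mathfrak u\subseteq\{1,\ldots,d\}}\max(|\mathfrak u|,1)\,\gamma_{\mathfrak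 u}^\lambda\,[2\zeta(\alpha\lambda)]^{|\mathfrak u|}\bigg)^{1/\lambda}.$$ Hence, for every $\delta>0$ such that $\lambda:=1/(\alpha-4\delta)$ lies in $(\frac1\alpha,1]$, with $M=n^{1/(2\lambda)}$, $$e^{\rm wor\text{-}app}_{n,d,M}(\boldsymbol z)=\mathcal O(n^{-\alpha/4+\delta}),$$ where the implied constant is independent of $n$, and is also independent of $d$ provided that $$\sum_{\mathfrak u\subset\mathbb N,\,|\mathfrak u|<\infty}\max(|\mathfrak u|,1)\,\gamma_{\mathfrak u}^{\frac1{\alpha-4\delta}}\,\big[2\zeta\big(\tfrac{\alpha}{\alpha-4\delta}\big)\big]^{|\mathfrak u|}<\infty.$$ Moreover, if for a given value of $\lambda\in(\frac1\alpha,1]$ the weights satisfy, for some constant $\xi\ge1$ (which may depend on $\lambda$), $$\gamma_{\mathfrak u\cup\mathfrak w}^\lambda\le\xi\,\frac{\gamma_{\mathfrak u}^\lambda}{[2\zeta(\alpha\lambda)]^{|\mathfrak w|}}\quad\text{for all }\mathfrak u\subseteq\{1,\ldots,s\},\ \mathfrak w\subseteq\{s+1,\ldots,d'\},\ s\ge1,\ d'\ge1,$$ then for this $\lambda$, with the same $\tau=\max(6,\,2.5+2^{2\alpha\lambda+1})$, for every $M>0$, $$e^{\rm wor\text{-}app}_{n,d,M}(\boldsymbol z)\le\Big(\frac1M+M\,S_d(\boldsymbol z)\Big)^{1/2}\le\Bigg(\frac1M+M\bigg[\frac{\tau\,\xi}{n}\bigg(\sum_{\emptyset\ne\mathfrak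 u\subseteq\{1,\ldots,d\}}\gamma_{\mathfrak u}^\lambda\,[2\zeta(\alpha\lambda)]^{|\mathfrak u|}\bigg)\bigg(\sum_{\mathfrak u\subseteq\{1,\ldots,d\}}\gamma_{\mathfrak u}^\lambda\,[2\zeta(\alpha\lambda)]^{|\mathfrak u|}\bigg)\bigg]^{1/\lambda}\Bigg)^{1/2},$$ and, taking $M=n^{1/(2\lambda)}$, $$e^{\rm wor\text{-}app}_{n,d,M}(\boldsymbol z)\le\frac{\sqrt2\,(\tau\,\xi)^{1/(2\lambda)}}{n^{1/(4\lambda)}}\bigg(\sum_{\mathfrak u\subseteq\{1,\ldots,d\}}\gamma_{\mathfrak u}^\lambda\,[2\zeta(\alpha\lambda)]^{|\mathfrak u|}\bigg)^{1/\lambda};$$ in particular, if this $\lambda$ equals $1/(\alpha-4\delta)$ with $\delta>0$, then with $M=n^{1/(2\lambda)}$ we have $e^{\rm wor\text{-}app}_{n,d,M}(\boldsymbol z)=\mathcal O(n^{-\alpha/4+\delta})$, where the implied constant is independent of $n$, and is also independent of $d$ provided that $$\sum_{\mathfrak u\subset\mathbb N,\,|\mathfrak u|<\infty}\gamma_{\mathfrak u}^{\frac1{\alpha-4\delta}}\,\big[2\zeta\big(\tfrac{\alpha}{\alpha-4\delta}\big)\big]^{|\mathfrak u|}<\infty.$$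
   Context: Notation: $\mathbb N=\{1,2,\ldots\}$; $\zeta(x)=\sum_{h\ge1}h^{-x}$ is the Riemann zeta function; $\equiv_n$ is congruence modulo $n$; $\mathrm{supp}(\boldsymbol h)=\{j:h_j\ne0\}$; $\{s+1,\ldots,d\}$ is empty if $s\ge d$; braces around a real vector inside $f$ denote componentwise fractional part. Function space: for $\boldsymbol h\in\mathbb Z^d$ let $r(\boldsymbol h)=\frac{1}{\gamma_{\mathrm{supp}(\boldsymbol h)}}\prod_{j\in\mathrm{supp}(\boldsymbol h)}|h_j|^\alpha$, and (without weight) $r'(\boldsymbol h)=\prod_{j\in\mathrm{supp}(\boldsymbol h)}|h_j|^\alpha$. If $\gamma_{\mathrm{supp}(\boldsymbol h)}=0$ then $r(\boldsymbol h)=+\infty$ and $1/r(\boldsymbol h)=0$. $H_d$ is the Hilbert space of one-periodic (in each variable) real-valued $L_2$ functions $f$ on $[0,1]^d$ with absolutely convergent Fourier series $f(\boldsymbol x)=\sum_{\boldsymbol h\in\mathbb Z^d}\hat f_{\boldsymbol h}e^{2\pi\mathrm i\boldsymbol h\cdot\boldsymbol x}$, $\hat f_{\boldsymbol h}=\int_{[0,1]^d}f(\boldsymbol x)e^{-2\pi\mathrm i\boldsymbol h\cdot\boldsymbol x}\,d\boldsymbol x$, with finite norm $\|f\|_d^2=\sum_{\boldsymbol h\in\mathbb Z^d}|\hat f_{\boldsymbol h}|^2r(\boldsymbol h)$ (with $0\cdot\infty=0$, so $\hat f_{\boldsymbol h}=0$ whenever $r(\boldsymbol h)=\infty$). Lattice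 algorithm: $\mathcal A_d(M)=\{\boldsymbol h\in\mathbb Z^d:r(\boldsymbol h)\le M\}$ and $$A(f)(\boldsymbol x)=\sum_{\boldsymbol h\in\mathcal A_d(M)}\hat f^a_{\boldsymbol h}\,e^{2\pi\mathrm i\boldsymbol h\cdot\boldsymbol x},\qquad\hat f^a_{\boldsymbol h}=\frac1n\sum_{k=1}^nf\Big(\Big\{\frac{k\boldsymbol z}{n}\Big\}\Big)e^{-2\pi\mathrm ik\boldsymbol h\cdot\boldsymbol z/n}.$$ The worst case $L_2$ approximation error is $e^{\rm wor\text{-}app}_{n,d,M}(\boldsymbol z)=\sup_{f\in H_d,\,\|f\|_d\le1}\|f-A(f)\|_{L_2([0,1]^d)}$. Error criterion: $$S_d(\boldsymbol z)=\sum_{\boldsymbol h\in\mathbb Z^d}\frac1{r(\boldsymbol h)}\sum_{\boldsymbol\ell\in\mathbb Z^d\setminus\{\boldsymbol0\},\ \boldsymbol\ell\cdot\boldsymbol z\equiv_n0}\frac1{r(\boldsymbol h+\boldsymbol\ell)}.$$ CBC construction: for $s\ge1$, integers $z_1,\ldots,z_s$ and nonnegative numbers $\{\beta_{\mathfrak u}\}_{\mathfrak u\subseteq\{1,\ldots,s\}}$ put $$\theta_s(z_1,\ldots,z_s;\{\beta_{\mathfrak u}\}_{\mathfrak u\subseteq\{1,\ldots,s\}})=\sum_{\boldsymbol h\in\mathbb Z^s}\ \sum_{\boldsymbol\ell\in\mathbb Z^s,\ \ell_s\ne0,\ \boldsymbol\ell\cdot(z_1,\ldots,z_s)\equiv_n0}\frac{\beta_{\mathrm{supp}(\boldsymbol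 h)}}{r'(\boldsymbol h)}\,\frac{\beta_{\mathrm{supp}(\boldsymbol h+\boldsymbol\ell)}}{r'(\boldsymbol h+\boldsymbol\ell)},$$ and for $1\le s\le d$ $$T_{d,s}(z_1,\ldots,z_s)=\sum_{\mathfrak w\subseteq\{s+1,\ldots,d\}}[2\zeta(2\alpha)]^{|\mathfrak w|}\,\theta_s(z_1,\ldots,z_s;\{\gamma_{\mathfrak u\cup\mathfrak w}\}_{\mathfrak u\subseteq\{1,\ldots,s\}}),$$ where the $\theta_s$ in the sum is evaluated with $\beta_{\mathfrak u}=\gamma_{\mathfrak u\cup\mathfrak w}$. A vector $\boldsymbol z=(z_1,\ldots,z_d)$ is obtained from the CBC construction if, for each $s=1,\ldots,d$ in turn, with $z_1,\ldots,z_{s-1}$ already fixed, $z_s$ is chosen in $\{1,\ldots,n-1\}$ to minimize $T_{d,s}(z_1,\ldots,z_{s-1},\,\cdot\,)$. *)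

(* Defs.v *)
From HB Require Import structures.
From mathcomp Require Import all_boot all_order all_algebra.
From mathcomp Require Import finmap.
From mathcomp Require Import all_classical all_reals all_analysis.
From mathcomp Require Import complex.

Set Implicit Arguments.
Unset Strict Implicit.
Unset Printing Implicit Defensive.

Import Order.TTheory GRing.Theory Num.Theory.
Import numFieldNormedType.Exports.
Import ComplexField.Normc.

Local Open Scope classical_set_scope.
Local Open Scope ring_scope.

(* Coordinates are numbered from 0: the index j of the literature is the natural
   number j - 1 here.  Finite sets of indices are values of {fset nat}, so that
   one weight family serves all dimensions d, and "{s+1, ..., d}" is the set
   [coords s d] of the naturals i with s <= i < d. *)

Definition coords (s d : nat) : {fset nat} := [fset j in index_iota s d]%fset.

Definition supp (d : nat) (h : {ffun 'I_d -> int}) : {fset nat} :=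
  [fset val j | j in 'I_d & h j != 0]%fset.

Section unit_cube_measure.
Context (R : realType).

Definition lebesgue01 : set (measurableTypeR R) -> \bar R :=
  mrestr (@lebesgue_measure R) (measurable_itv `[0%R, 1%R]).

HB.instance Definition _ := Measure.on lebesgue01.

Let lebesgue01_setT : lebesgue01 [set: measurableTypeR R] = 1%E.
Proof.
by rewrite /lebesgue01 /mrestr setTI lebesgue_measure_itv/= lte01 oppr0 adde0.
Qed.

HB.instance Definition _ :=
  Measure_isProbability.Build _ _ _ lebesgue01 lebesgue01_setT.

Definition tcons (d : nat)
    (p : measurableTypeR R * d.-tuple (measurableTypeR R)) :
  d.+1.-tuple (measurableTypeR R) := [tuple of p.1 :: p.2].

Let measurable_tcons d : measurable_fun [set: _] (@tcons d).
Proof. exact: measurable_cons. Qed.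

HB.instance Definition _ d :=
  isMeasurableFun.Build _ _ _ _ (@tcons d) (@measurable_tcons d).

(* d-dimensional Lebesgue measure restricted to [0,1]^d *)
Fixpoint cube (d : nat) : probability (d.-tuple (measurableTypeR R)) R :=
  match d with
  | 0 => dirac [tuple]
  | d'.+1 => distribution (lebesgue01 \x cube d')%E (@tcons d')
  end.

End unit_cube_measure.

Section complex_analysis.
Context (R : realType).

Definition expi (t : R) : R[i] := (cos t +i* sin t)%C.

Definition Cintegral (dd : measure_display) (T : measurableType dd)
    (mu : {measure set T -> \bar R}) (g : T -> R[i]) : R[i] :=
  ((\int[mu]_x complex.Re (g x)) +i* (\int[mu]_x complex.Im (g x)))%C.

Definition has_sum (I : choiceType) (a : I -> R[i]) (l : R[i]) : Prop :=
  forall e : R, 0 < e -> exists A : {fset I}, forall B : {fset I},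
    (A `<=` B)%fset -> normc (\sum_(i <- B) a i - l) < e.

Definition zeta (x : R) : R := limn (series (fun k => k.+1%:R `^ (- x))).

Definition fracpart (x : R) : R := x - (Num.floor x)%:~R.

End complex_analysis.

Section korobov.
Context (R : realType) (alpha : R) (gamma : {fset nat} -> R).

Definition rprime (d : nat) (h : {ffun 'I_d -> int}) : R :=
  \prod_(j < d | h j != 0) `|(h j)%:~R| `^ alpha.

(* Division is that of \bar R, so that rfun h = +oo if gamma (supp h) = 0, and
   then (rfun h)^-1 = 0 as well as 0 * rfun h = 0. *)
Definition rfun (d : nat) (h : {ffun 'I_d -> int}) : \bar R :=
  ((rprime h)%:E / (gamma (supp h))%:E)%E.

Section dimension.
Context (d : nat).
Local Notation point := (d.-tuple (measurableTypeR R)).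
Local Notation freq := {ffun 'I_d -> int}.

Definition dot (h : freq) (x : point) : R :=
  \sum_(j < d) (h j)%:~R * tnth x j.

Definition unit_shift (j : 'I_d) (x : point) : point :=
  [tuple (if i == j then tnth x i + 1 else tnth x i) | i < d].

Definition fourier (f : point -> R) (h : freq) : R[i] :=
  Cintegral (cube R d) (fun x => (f x)%:C%C * expi (- (2 * pi * dot h x))).

Definition korobov_norm (f : point -> R) : \bar R :=
  (((\esum_(h in [set: freq]) ((normc (fourier f h) ^+ 2)%:E * rfun h))
     `^ 2^-1)%E).

(* Functions are given on all of R^d, and are equal everywhere (not just almost
   everywhere) to their Fourier series. *)
Definition korobov (f : point -> R) : Prop :=
  [/\ forall j x, f (unit_shift j x) = f x,
      measurable_fun [set: point] f /\
        (Lnorm (cube R d) 2%:E (EFin \o f) < +oo)%E,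
      (\esum_(h in [set: freq]) (normc (fourier f h))%:E < +oo)%E,
      forall x, has_sum (fun h => fourier f h * expi (2 * pi * dot h x)) (f x)%:C%C
    & (korobov_norm f < +oo)%E].

Definition index_set (M : R) : set freq := [set h | (rfun h <= M%:E)%E].

Definition lattice_point (n : nat) (z : d.-tuple nat) (k : nat) : point :=
  [tuple fracpart ((k * tnth z j)%:R / n%:R) | j < d].

Definition lattice_coef (n : nat) (z : d.-tuple nat) (f : point -> R)
    (h : freq) : R[i] :=
  n%:R^-1 * \sum_(1 <= k < n.+1)
    (f (lattice_point n z k))%:C%C *
    expi (- (2 * pi * k%:R * (\sum_(j < d) (h j)%:~R * (tnth z j)%:R) / n%:R)).

(* index_set M is finite (as alpha > 0), so the finitely supported sum below is
   the full sum over it. *)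
Definition lattice_alg (n : nat) (M : R) (z : d.-tuple nat) (f : point -> R)
    (x : point) : R[i] :=
  \sum_(h \in index_set M) lattice_coef n z f h * expi (2 * pi * dot h x).

(* lattice_alg is complex valued, so the error is measured with the complex
   modulus; the supremum is taken in \bar R. *)
Definition wor_app (n : nat) (M : R) (z : d.-tuple nat) : \bar R :=
  ereal_sup
    [set Lnorm (cube R d) 2%:E
           (fun x => (normc ((f x)%:C%C - lattice_alg n M z f x))%:E)
    | f in [set f | korobov f /\ (korobov_norm f <= 1)%E]].

End dimension.

(* l . (z_1, ..., z_s) = 0 mod n; only the first s entries of z matter *)
Definition dual_lattice (n s : nat) (z : seq nat) : set {ffun 'I_s -> int} :=
  [set l | (n%:Z %| \sum_(j < s) l j * (nth 0%N z j)%:Z)%Z].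

Definition S_crit (n d : nat) (z : d.-tuple nat) : \bar R :=
  (\esum_(h in [set: {ffun 'I_d -> int}])
     ((rfun h)^-1 * \esum_(l in [set l | l != 0%R /\ dual_lattice n z l])
                    (rfun (h + l)%R)^-1))%E.

(* [s.-1] is the (0-based) last coordinate: the condition on l is l_s != 0. *)
Definition theta (n s : nat) (z : seq nat) (beta : {fset nat} -> R) : \bar R :=
  (\esum_(h in [set: {ffun 'I_s -> int}])
     \esum_(l in [set l | s.-1 \in supp l /\ dual_lattice n z l])
        (beta (supp h) / rprime h * (beta (supp (h + l)) / rprime (h + l)))%:E)%E.

Definition T_crit (n d s : nat) (z : seq nat) : \bar R :=
  (\sum_(w <- fpowerset (coords s d))
     ((2 * zeta (2 * alpha)) ^+ #|` w|)%:E
       * theta n s z (fun u => gamma (u `|` w)%fset))%E.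

(* [s : 'I_d] stands for the step that chooses the component z_{s+1}. *)
Definition is_cbc (n d : nat) (z : d.-tuple nat) : Prop :=
  forall s : 'I_d,
    (1 <= tnth z s <= n.-1)%N /\
    forall c : nat, (1 <= c <= n.-1)%N ->
      (T_crit n d s.+1 (take s.+1 z) <= T_crit n d s.+1 (rcons (take s z) c))%E.

End korobov.

Definition tau (R : realType) (alpha lambda : R) : R :=
  Num.max 6 (5 / 2 + 2 `^ (2 * alpha * lambda + 1)).

Definition wterm (R : realType) (alpha : R) (gamma : {fset nat} -> R)
    (lambda : R) (u : {fset nat}) : R :=
  gamma u `^ lambda * (2 * zeta (alpha * lambda)) ^+ #|` u|.

(* Main.v *)
(* Error bound.  The n lattice points alias the frequencies that differ by an
   element of the dual lattice, so the coefficient error at h in A_d(M) is the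
   sum of the f^_(h + l) over dual l <> 0; Cauchy-Schwarz bounds its square by
   the sum of the 1/r(h + l), and 1 <= M/r(h).  Outside A_d(M) one uses
   r(h) > M.  Only the inequality ||g||^2 <= sum |g^_h|^2 of Parseval is needed:
   it follows from Fatou's lemma and orthogonality.

   Criterion.  S_d is the sum of the T_(d,s): a pair (h, h + l) is sorted by
   the last coordinate s in which its members differ, and the common tail of
   the two frequencies contributes the powers of 2 zeta(2 alpha).  Since z_s
   minimizes T_(d,s), T_(d,s)^lambda is at most its average over the n - 1
   candidates; the power lambda <= 1 is taken termwise, and l is dual for all
   candidates only if n divides l_s, and otherwise for at most one of them.
   With x = alpha lambda, this bounds the average by a sum over pairs that
   factors along supports; with P, Q the sums of the weight terms over the
   supports containing, resp. not containing, s, the total is at most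
   (6 P Q + (2^(x+1) + 2) P^2)/n <= tau P (P + Q)/n.  Summing over s counts
   each nonempty support |u| times.  Under the additional condition on the
   weights, the sum over the tails can be absorbed, and only the supports with
   largest element s remain in P, so that each u is counted once. *)

Require Import Defs.
From HB Require Import structures.
From mathcomp Require Import all_boot all_order all_algebra.
From mathcomp Require Import finmap.
From mathcomp Require Import all_classical all_reals all_analysis.
From mathcomp Require Import measurable_realfun complex ring lra.

Set Implicit Arguments.
Unset Strict Implicit.
Unset Printing Implicit Defensive.

Import Order.TTheory GRing.Theory Num.Theory.
Import numFieldNormedType.Exports.

Local Open Scope classical_set_scope.
Local Open Scope ring_scope.

(** * Sums of negative powers *)

(** S_d and theta_s are sums in [\bar R], and nothing makes them finite beforehand. The estimates
    are therefore proved for frequencies whose coordinates lie in a finite set F of integers, where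
    sums are finite and products distribute over coordinates, with bounds that do not depend on F;
    they then pass to the full sums. The decomposition of S_d is accordingly proved as an inequality
    whose left side is truncated.

    The weights may vanish, and then r = +oo; the basic quantity is therefore the real number 1/r,
    called [amp]. Its exponent and its weights are parameters: the power lambda turns alpha into
    alpha lambda and beta into beta^lambda, so that one estimate for pairs of frequencies serves
    every lambda. The tail factors fit into the same pattern because (2 zeta(2 alpha))^lambda <= 2
    zeta(alpha lambda).

    The choice M = n^(1/(2 lambda)) equalizes 1/M and M n^(-1/lambda). *)

Section zeta_sums.
Context (R : realType).
Implicit Types (x p : R).

(* Splitting the sum over k <= 2N + 1 into even and odd k bounds it by
   1 + 2^(1-x) times itself. *)
Lemma riemann_sum_bound x : 1 < x ->
  forall N, series (fun k => k.+1%:R `^ (- x)) N <= (1 - 2 `^ (1 - x))^-1 :> R.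
Proof.
move=> x1; pose S := series (fun k => k.+1%:R `^ (- x)) : nat -> R.
have Smono : {homo S : m n / (m <= n)%N >-> m <= n}.
  by apply/nondecreasing_seqP => n; rewrite /S seriesSr lerDl powR_ge0.
have q1 : 2 `^ (1 - x) < 1 :> R.
  rewrite -[ltRHS](powRr0 2) /powR pnatr_eq0/= ltr_expR ltr_pM2r ?ln_gt0 ?ltr1n //.
  by rewrite subr_lt0.
have Srec N : S N.*2.+1 <= 1 + 2 `^ (1 - x) * S N.
  elim: N => [|N IH].
    by rewrite /S !seriesSr /= /series/= big_geq // mulr0 addr0 powR1 add0r.
  have SS m : S m.+1 = S m + m.+1%:R `^ (- x) by rewrite /S seriesSr.
  rewrite doubleS SS SS (SS N) mulrDr addrA -[leLHS]addrA.
  apply: lerD => //.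
  have h k : (N.+1.*2 <= k)%N -> k%:R `^ (- x) <= (2 * N.+1%:R) `^ (- x) :> R.
    move=> Nk; rewrite !powRN lef_pV2 ?posrE ?powR_gt0 ?mulr_gt0//; last first.
      by rewrite ltr0n (leq_trans _ Nk).
    rewrite ge0_ler_powR ?nnegrE ?(le_trans ler01 (ltW x1))//.
    by rewrite -natrM ler_nat mul2n.
  have -> : 2 `^ (1 - x) * N.+1%:R `^ (- x) = 2 * (2 * N.+1%:R) `^ (- x) :> R.
    rewrite powRD; last by rewrite pnatr_eq0 implybT.
    by rewrite powRr1// -mulrA -powRM.
  rewrite [leRHS]mulr_natl mulr2n; apply: lerD; apply: h; rewrite doubleS //.
move=> N; rewrite -[leRHS]div1r ler_pdivlMr ?subr_gt0//.
apply: (@le_trans _ _ (S N.*2.+1 * (1 - 2 `^ (1 - x)))).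
  apply: ler_wpM2r; first by rewrite subr_ge0 ltW.
  by apply: Smono; rewrite -addnn -addSn leq_addl.
rewrite mulrBr mulr1 lerBlDr (le_trans (Srec N))// lerD2l mulrC.
apply: ler_wpM2r; first exact: powR_ge0.
by apply: Smono; rewrite -addnn -addSn leq_addl.
Qed.

(** [zeta] is a [limn], which is informative only once the partial sums are known to converge; the
    explicit upper bound above supplies this. *)
Lemma riemann_sum_le_zeta x : 1 < x ->
  forall N, series (fun k => k.+1%:R `^ (- x)) N <= zeta x.
Proof.
move=> x1 N.
have Smono : nondecreasing_seq (series (fun k => k.+1%:R `^ (- x)) : nat -> R).
  by apply/nondecreasing_seqP => n; rewrite seriesSr lerDl powR_ge0.
apply: nondecreasing_cvgn_le => //; apply: nondecreasing_is_cvgn => //.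
by exists (1 - 2 `^ (1 - x))^-1 => _ [n _ <-]; exact: riemann_sum_bound.
Qed.

Lemma zeta_ge1 x : 1 < x -> 1 <= zeta x.
Proof.
move=> x1; apply: le_trans (riemann_sum_le_zeta x1 1).
by rewrite seriesSr /series/= big_geq // add0r powR1.
Qed.

Lemma zeta_le x p : (forall N, series (fun k => k.+1%:R `^ (- x)) N <= p) ->
  zeta x <= p.
Proof.
move=> h; have Smono : nondecreasing_seq (series (fun k => k.+1%:R `^ (- x)) : nat -> R).
  by apply/nondecreasing_seqP => n; rewrite seriesSr lerDl powR_ge0.
apply: limr_le; last exact: nearW.
by apply: nondecreasing_is_cvgn => //; exists p => _ [n _ <-].
Qed.

(** Jensen's inequality for sums. With two terms a, b, each fraction c/(a + b) <= 1 is at most its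
    own p-th power; adding the cases c = a and c = b gives the claim. *)
Lemma powR_sum_le (I : Type) (r : seq I) (P : pred I) (F : I -> R) p :
  0 < p <= 1 -> (forall i, P i -> 0 <= F i) ->
  (\sum_(i <- r | P i) F i) `^ p <= \sum_(i <- r | P i) F i `^ p.
Proof.
move=> /andP[p0 p1] F0; elim: r => [|i r IH].
  by rewrite !big_nil powR0// gt_eqF.
rewrite !big_cons; case: ifP => // Pi; apply: le_trans (lerD (lexx _) IH).
have := F0 _ Pi; have : 0 <= \sum_(j <- r | P j) F j by exact: sumr_ge0.
move: (F i) (\sum_(j <- r | P j) F j) => a b b0 a0.
have [->|/eqP ab0] := eqVneq (a + b) 0; first by rewrite powR0 ?gt_eqF// addr_ge0// powR_ge0.
have ab : 0 < a + b by rewrite lt_neqAle eq_sym addr_ge0// andbT; exact/eqP.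
have h (c : R) : 0 <= c <= a + b -> c / (a + b) * (a + b) `^ p <= c `^ p.
  move=> /andP[c0 cab].
  have [->|cn0] := eqVneq c 0; first by rewrite !mul0r powR_ge0.
  have cp : 0 < c by rewrite lt_neqAle eq_sym cn0.
  rewrite -[in leRHS](divfK (lt0r_neq0 ab) c) powRM ?divr_ge0 ?addr_ge0//.
  apply: ler_wpM2r; first exact: powR_ge0.
  by apply: ger1_powR => //; rewrite divr_gt0//= ler_pdivrMr// mul1r.
apply: le_trans (lerD (h a _) (h b _)); last 2 first.
- by rewrite a0 lerDl.
- by rewrite b0 lerDr.
by rewrite -mulrDl -mulrDl divff ?mul1r// lt0r_neq0.
Qed.

(** Partial sums of zeta(2x), raised to the power p, are at most those of zeta(2px), hence of
    zeta(px), and 2^p <= 2. The root [p^-1] is first taken on the right, so that the limit on the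
    left is bounded through its partial sums. This converts the factors of the common tails into
    those of the final bound. *)
Lemma powR_zeta_le x p : 0 < p <= 1 -> 1 < p * x ->
  (2 * zeta (2 * x)) `^ p <= 2 * zeta (p * x).
Proof.
move=> /andP[p0 p1] px1.
have x1 : 1 < x.
  by apply: (lt_le_trans px1); rewrite ler_piMl// ltW// -(pmulr_rgt0 _ p0) (lt_trans ltr01).
have Zp : 0 <= 2 * zeta (p * x).
  by rewrite mulr_ge0// (le_trans ler01)// zeta_ge1.
have Z2 : 1 <= zeta (2 * x) by apply: zeta_ge1; lra.
have pV (y : R) : 0 <= y -> y = (y `^ p) `^ p^-1.
  by move=> y0; rewrite -powRrM mulfV ?lt0r_neq0// powRr1.
have pV' (y : R) : 0 <= y -> y = (y `^ p^-1) `^ p.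
  by move=> y0; rewrite -powRrM mulVf ?lt0r_neq0// powRr1.
rewrite [leRHS]pV'//.
apply: ge0_ler_powR; rewrite ?(ltW p0)// ?nnegrE ?powR_ge0 ?(mulr_ge0, le_trans ler01 Z2)//.
rewrite -ler_pdivlMl//; apply: zeta_le => N.
rewrite ler_pdivlMl// [leLHS]pV; last by rewrite mulr_ge0// sumr_ge0// => i _; exact: powR_ge0.
apply: ge0_ler_powR; rewrite ?nnegrE ?powR_ge0 ?invr_ge0 ?(ltW p0)//.
rewrite powRM//; last by rewrite sumr_ge0// => i _; exact: powR_ge0.
apply: ler_pM; rewrite ?powR_ge0//; first by rewrite ler1_powR// ler1n.
apply: le_trans (riemann_sum_le_zeta px1 N).
rewrite seriesEnat/=; apply: le_trans (powR_sum_le _ _ _) _; first by rewrite p0.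
  by move=> i _; exact: powR_ge0.
rewrite seriesEnat/=; apply: ler_sum => i _; rewrite -powRrM ler_powR ?ler1n//.
by rewrite mulNr lerN2; lra.
Qed.

(** Each k >= 1 is the absolute value of at most two of the distinct integers [q i], namely k and
    -k. The indexing by [q] covers both the frequencies themselves and quotients of differences by
    n. *)
Lemma int_sum_le_zeta x (I : finType) (P : pred I) (q : I -> int) : 1 < x ->
  {in P &, injective q} -> (forall i, P i -> q i != 0) ->
  \sum_(i | P i) `|(q i)%:~R| `^ (- x) <= 2 * zeta x.
Proof.
move=> x1 qinj q0.
pose N := \max_(i | P i) `|q i|%N.
apply: (@le_trans _ _ (2 * series (fun k => k.+1%:R `^ (- x)) N)); last first.
  by rewrite ler_pM2l// riemann_sum_le_zeta.
rewrite seriesEnat/= big_mkord mulr_sumr.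
apply: (@le_trans _ _ (\sum_(i | P i) \sum_(k < N | k.+1 == `|q i|%N) k.+1%:R `^ (- x))).
  apply: ler_sum => i Pi.
  have qN : (`|q i|.-1 < N)%N.
    rewrite prednK ?absz_gt0 ?q0//; exact: (@leq_bigmax_cond _ P (fun i => `|q i|%N)).
  rewrite (big_pred1 (Ordinal qN)) => [|k]; last first.
    by rewrite /= -[in LHS](prednK (n := `|q i|)) ?absz_gt0 ?q0.
  by rewrite /= prednK ?absz_gt0 ?q0// natr_absz intr_norm.
rewrite (exchange_big_dep xpredT)//=; apply: ler_sum => k _.
rewrite (eq_bigl (mem [pred i | P i && (k.+1 == `|q i|%N)]))// sumr_const -[leLHS]mulr_natl; apply: ler_wpM2r; first exact: powR_ge0.
rewrite ler_nat.
have -> : 2%N = size [:: (k.+1%:Z); - (k.+1%:Z)] by [].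
rewrite cardE -(size_map q); apply: uniq_leq_size.
  rewrite map_inj_in_uniq ?enum_uniq// => i j; rewrite !mem_enum !inE.
  by move=> /andP[Pi _] /andP[Pj _]; exact: qinj.
move=> m; case/(@mapP I int q _ m) => i; rewrite mem_enum !inE => /andP[Pi /eqP ki] ->.
by case: (q i) ki => [j|j] /= [->]; rewrite ?eqxx// NegzE eqxx orbT.
Qed.

End zeta_sums.

(** * Decay in one coordinate and congruences modulo n *)

Section korobov_weights.
Context (R : realType).
Implicit Types (x p : R) (m : int) (F : {fset int}) (u w : {fset nat}).

(** The factor of 1/r' from one coordinate, equal to 1 outside the support. The exponent is a
    parameter, so the family is closed under powers. *)
Definition decay x m : R := if m == 0 then 1 else `|m%:~R| `^ (- x).

Lemma decay_ge0 x m : 0 <= decay x m.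
Proof. by rewrite /decay; case: ifP => // _; exact: powR_ge0. Qed.

Lemma decay_neq0 x m : m != 0 -> decay x m = `|m%:~R| `^ (- x).
Proof. by rewrite /decay => /negPf ->. Qed.

Lemma decay_powR x p m : decay x m `^ p = decay (p * x) m.
Proof.
by rewrite /decay; case: ifP => _; rewrite ?powR1// -powRrM mulNr mulrC.
Qed.

Lemma decay_le x m (y : R) : 0 <= x -> 0 < y -> y <= `|m%:~R| ->
  decay x m <= y `^ (- x).
Proof.
move=> x0 y0 ym; have m0 : 0 < `|m%:~R : R| by exact: lt_le_trans ym.
rewrite decay_neq0; last by rewrite -(intr_eq0 R) -normr_gt0.
rewrite !powRN lef_pV2 ?posrE ?powR_gt0// ge0_ler_powR ?nnegrE//; exact: ltW.
Qed.

Lemma sum_decay_le x F : 1 < x ->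
  \sum_(m : F | val m != 0) decay x (val m) <= 2 * zeta x.
Proof.
move=> x1; under eq_bigr do rewrite decay_neq0//.
by apply: int_sum_le_zeta => // i j _ _; exact: val_inj.
Qed.

Lemma quotient_norm (n : nat) m : (0 < n)%N -> (n%:Z %| m)%Z ->
  `|m%:~R| = n%:R * `|(m %/ n%:Z)%Z%:~R| :> R.
Proof.
move=> n0 /divzK {1}<-.
by rewrite intrM normrM mulrC; congr (_ * _); rewrite ger0_norm// ler0n.
Qed.

Lemma sum_quotient_le x F (n : nat) (c : int) : 1 < x -> (0 < n)%N ->
  \sum_(m : F | (val m != c) && (n%:Z %| val m - c)%Z)
    `|((val m - c) %/ n%:Z)%Z%:~R| `^ (- x) <= 2 * zeta x :> R.
Proof.
move=> x1 n0; apply: int_sum_le_zeta => //.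
  move=> i j /andP[_ /divzK ni] /andP[_ /divzK nj] ij.
  by apply/val_inj/(addIr (- c)); rewrite -ni -nj ij.
move=> i /andP[ic /divzK ni]; apply: contra ic => /eqP q0.
by rewrite q0 mul0r in ni; rewrite -subr_eq0 -ni.
Qed.

Lemma sum_decay_dvd_le x F (n : nat) : 1 < x -> (0 < n)%N ->
  \sum_(m : F | (val m != 0) && (n%:Z %| val m)%Z) decay x (val m)
    <= n%:R `^ (- x) * (2 * zeta x).
Proof.
move=> x1 n0.
apply: le_trans (ler_wpM2l (powR_ge0 _ _) (sum_quotient_le F 0 x1 n0)).
rewrite mulr_sumr le_eqVlt; apply/orP; left; apply/eqP.
apply: eq_big => [m|m /andP[m0 nm]]; rewrite subr0//.
by rewrite decay_neq0// (quotient_norm n0 nm) powRM.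
Qed.

(* If n divides m' - m <> 0 then one of |m|, |m'| is at least n|q|/2, where
   q = (m' - m)/n. *)
Lemma decay_pair_le x (n : nat) m m' : 1 < x -> (0 < n)%N ->
  m != m' -> (n%:Z %| m' - m)%Z ->
  decay x m * decay x m' <=
    2 `^ x * n%:R `^ (- x) * `|((m' - m) %/ n%:Z)%Z%:~R| `^ (- x)
      * (decay x m + decay x m').
Proof.
move=> x1 n0 mm' nm; pose y : R := n%:R * `|((m' - m) %/ n%:Z)%Z%:~R| / 2.
have y0 : 0 < y.
  rewrite divr_gt0// -quotient_norm// normr_gt0 intr_eq0 subr_eq0.
  by rewrite eq_sym.
have x0 : 0 <= x by rewrite (le_trans ler01)// ltW.
have -> : 2 `^ x * n%:R `^ (- x) * `|((m' - m) %/ n%:Z)%Z%:~R| `^ (- x) = y `^ (- x).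
  rewrite /y !powRM ?mulr_ge0 ?invr_ge0// -[2^-1]powR_inv1// -powRrM.
  by rewrite mulN1r opprK; ring.
have: y <= `|m%:~R| \/ y <= `|m'%:~R|.
  have: 2 * y <= `|m%:~R| + `|m'%:~R|.
    rewrite /y mulrC divfK// -quotient_norm// intrB [leRHS]addrC; exact: ler_normB.
  by move=> h; case: (leP y `|m%:~R|) => [|h']; [left|right; lra].
case=> h.
  apply: le_trans (ler_wpM2r (decay_ge0 _ _) (decay_le x0 y0 h)) _.
  by rewrite ler_wpM2l ?powR_ge0// lerDr decay_ge0.
apply: le_trans (ler_wpM2l (decay_ge0 _ _) (decay_le x0 y0 h)) _.
by rewrite mulrC ler_wpM2l ?powR_ge0// lerDl decay_ge0.
Qed.

(** [decay_pair_le] leaves two sums that the exchange of m and m' identifies, whence 2 * 2^x =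
    2^(x+1). For fixed m the quotients (m' - m)/n are distinct nonzero integers, which gives one
    factor 2 zeta(x); the sum over m gives the other. *)
Lemma sum_decay_pair_le x F (n : nat) : 1 < x -> (0 < n)%N ->
  \sum_(m : F | val m != 0) \sum_(m' : F | [&& val m' != 0, m != m' &
      (n%:Z %| val m' - val m)%Z]) decay x (val m) * decay x (val m')
    <= 2 `^ (x + 1) * n%:R `^ (- x) * (2 * zeta x) ^+ 2.
Proof.
move=> x1 n0; set D := 2 `^ x * n%:R `^ (- x).
have D0 : 0 <= D by rewrite mulr_ge0 ?powR_ge0.
pose q (m m' : F) : R := `|((val m' - val m) %/ n%:Z)%Z%:~R| `^ (- x).
have qC (m m' : F) : (n%:Z %| val m' - val m)%Z -> q m m' = q m' m.
  move=> nm; have nm' : (n%:Z %| val m - val m')%Z by rewrite -opprB rpredN.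
  have nR : n%:R != 0 :> R by rewrite pnatr_eq0 -lt0n.
  rewrite /q; congr (_ `^ _); apply: (mulfI nR).
  by rewrite -!quotient_norm// !intrB distrC.
have half : \sum_(m : F | val m != 0) \sum_(m' : F | (val m' != val m) &&
    (n%:Z %| val m' - val m)%Z) D * q m m' * decay x (val m)
    <= D * (2 * zeta x) ^+ 2.
  under eq_bigr do (under eq_bigr do rewrite -mulrA; rewrite -mulr_sumr -mulr_suml).
  rewrite -mulr_sumr; apply: ler_wpM2l => //.
  rewrite expr2; apply: le_trans (ler_wpM2l _ (sum_decay_le F x1)); last first.
    by rewrite mulr_ge0// (le_trans ler01)// zeta_ge1.
  rewrite mulr_sumr; apply: ler_sum => m _; apply: ler_wpM2r; first exact: decay_ge0.
  exact: sum_quotient_le.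
have -> : 2 `^ (x + 1) * n%:R `^ (- x) * (2 * zeta x) ^+ 2 =
    D * (2 * zeta x) ^+ 2 + D * (2 * zeta x) ^+ 2.
  rewrite powRD; last by rewrite pnatr_eq0 implybT.
  by rewrite powRr1// /D; ring.
apply: le_trans (lerD half half).
pose S1 := \sum_(m : F | val m != 0) \sum_(m' : F | [&& val m' != 0, m != m' &
      (n%:Z %| val m' - val m)%Z]) D * q m m' * decay x (val m).
pose S2 := \sum_(m : F | val m != 0) \sum_(m' : F | [&& val m' != 0, m != m' &
      (n%:Z %| val m' - val m)%Z]) D * q m m' * decay x (val m').
have S12 : S1 = S2.
  rewrite /S1 /S2 [RHS](exchange_big_dep (fun m : F => val m != 0))/=; last first.
    by move=> i j _ /and3P[].
  apply: eq_bigr => m m0; apply: eq_big => [m'|m' /and3P[_ _ nm]]; last by rewrite qC.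
  rewrite m0/= [m' == m]eq_sym -opprB rpredN.
  by case: (val m' != 0); rewrite ?andbF.
apply: (@le_trans _ _ (S1 + S2)).
  rewrite -big_split; apply: ler_sum => m m0/=; rewrite -big_split; apply: ler_sum => m'.
  by case/and3P => _ mm' nm; rewrite /= -mulrDr decay_pair_le// (inj_eq val_inj).
rewrite -S12; apply: lerD; apply: ler_sum => m m0; rewrite big_mkcond [leRHS]big_mkcond;
  apply: ler_sum => m' _; rewrite -(inj_eq val_inj) [val m == _]eq_sym;
  case: (val m' != 0) => //=; case: ifP => // _; rewrite !mulr_ge0// ?powR_ge0 ?decay_ge0//.
Qed.

End korobov_weights.

(** * Pairs of frequencies grouped by support *)

Section support_sums.
Context (R : realType).
Implicit Types (x p : R) (F : {fset int}) (u w : {fset nat}).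

Lemma mem_coords (s d j : nat) : (j \in coords s d) = (s <= j < d)%N.
Proof. by rewrite !inE mem_index_iota. Qed.

Lemma mem_supp s (h : {ffun 'I_s -> int}) (j : 'I_s) :
  (val j \in supp h) = (h j != 0).
Proof.
apply/imfsetP/idP => [[k]|hj]; last by exists j.
by rewrite !inE => hk /val_inj ->.
Qed.

Lemma supp_coords s (h : {ffun 'I_s -> int}) : (supp h `<=` coords 0 s)%fset.
Proof. by apply/fsubsetP => i /imfsetP[j _ ->]; rewrite mem_coords/=. Qed.

Lemma supp_eq s (h : {ffun 'I_s -> int}) u : (u `<=` coords 0 s)%fset ->
  (u == supp h) = [forall j : 'I_s, (h j != 0) == (val j \in u)].
Proof.
move=> us; apply/eqP/forallP => [-> j|hu]; first by rewrite mem_supp.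
apply/fsetP => i; case: (ltnP i s) => [lis|sli].
  have := hu (Ordinal lis); rewrite -mem_supp/= => /eqP ->.
  by [].
apply/idP/idP => [/(fsubsetP us)|/(fsubsetP (supp_coords h))];
  by rewrite mem_coords/= ltnNge sli.
Qed.

(** Frequencies with coordinates in the finite set [F] form a finite type, over which big operators
    apply; [fext] embeds them among all frequencies. *)
Definition fext s F (h : {ffun 'I_s -> F}) : {ffun 'I_s -> int} :=
  [ffun j => val (h j)].

Lemma fext_inj s F : injective (@fext s F).
Proof.
move=> h k /ffunP hk; apply/ffunP => j.
by have := hk j; rewrite !ffunE; exact: val_inj.
Qed.

(** The weight depends on the support alone, and fixing the support is a condition on each
    coordinate separately, so the remaining sum of products is a product of sums. *)
Lemma sum_by_supp s F (beta : {fset nat} -> R) (G : 'I_s -> F -> R) :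
  \sum_(h : {ffun 'I_s -> F}) beta (supp (fext h)) * \prod_j G j (h j) =
  \sum_(u <- fpowerset (coords 0 s)) beta u *
     \prod_j \sum_(m : F | (val m != 0) == (val j \in u)) G j m.
Proof.
under eq_bigr => h _.
  rewrite (_ : _ * _ = \sum_(u <- fpowerset (coords 0 s) | u == supp (fext h))
    beta u * \prod_j G j (h j)); last first.
    rewrite -[RHS]big_filter (_ : seq.filter _ _ = [:: supp (fext h)]) ?big_seq1//.
    by apply: filter_pred1_uniq; rewrite ?fset_uniq// fpowersetE supp_coords.
  over.
rewrite (exchange_big_dep xpredT)//= big_seq [RHS]big_seq; apply: eq_bigr => u.
rewrite fpowersetE => us; rewrite -mulr_sumr; congr (_ * _).
rewrite bigA_distr_big_dep; apply: eq_bigl => h.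
rewrite supp_eq//; apply/forallP/familyP => H j; have := H j; by rewrite ffunE unfold_in.
Qed.

Lemma count_mem_coords s u : (u `<=` coords 0 s)%fset ->
  count (mem u) (index_iota 0 s) = #|` u|.
Proof.
move=> us; rewrite -size_filter; apply/perm_size/uniq_perm.
- by rewrite filter_uniq// iota_uniq.
- exact: fset_uniq.
move=> j; rewrite mem_filter mem_index_iota/=; case ju : (j \in u) => //=.
by have := fsubsetP us j ju; rewrite mem_coords.
Qed.

Lemma prod_mem_coords s (Z : R) u : (u `<=` coords 0 s)%fset ->
  \prod_(j < s) (if val j \in u then Z else 1) = Z ^+ #|` u|.
Proof.
move=> us; rewrite -(big_mkord xpredT (fun j => if j \in u then Z else 1)).
by rewrite -big_mkcond big_const_seq iter_mulr_1 -(count_mem_coords us).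
Qed.

(** For x = alpha and beta = gamma this is 1/r(h) as a real number, equal to 0 where the weight
    vanishes and r is infinite. *)
Definition amp x s (beta : {fset nat} -> R) (h : {ffun 'I_s -> int}) : R :=
  beta (supp h) * \prod_j decay x (h j).

Lemma amp_ge0 x s (beta : {fset nat} -> R) (h : {ffun 'I_s -> int}) : (forall u, 0 <= beta u) ->
  0 <= amp x beta h.
Proof. by move=> b0; rewrite mulr_ge0// prodr_ge0// => j _; exact: decay_ge0. Qed.

Lemma powR_prod (I : Type) (r : seq I) (g : I -> R) p : (forall i, 0 <= g i) ->
  (\prod_(i <- r) g i) `^ p = \prod_(i <- r) g i `^ p.
Proof.
move=> g0; elim: r => [|i r IH]; first by rewrite !big_nil powR1.
by rewrite !big_cons powRM ?IH// prodr_ge0.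
Qed.

Lemma amp_powR x p s (beta : {fset nat} -> R) (h : {ffun 'I_s -> int}) : (forall u, 0 <= beta u) ->
  amp x beta h `^ p = amp (p * x) (fun u => beta u `^ p) h.
Proof.
move=> b0; rewrite /amp powRM//; last by rewrite prodr_ge0// => j _; exact: decay_ge0.
congr (_ * _); rewrite powR_prod; last by move=> j; exact: decay_ge0.
by apply: eq_bigr => j _; rewrite decay_powR.
Qed.

(** [F] contains 0 or not, so the sum has at most one term; [0 <= B] settles the empty case. *)
Lemma sum_zero_le F (f : F -> R) (B : R) : 0 <= B ->
  (forall m, val m == 0 -> f m <= B) -> \sum_(m : F | val m == 0) f m <= B.
Proof.
move=> B0 fB; have [z0|z0] := pselect (0 \in F).
  rewrite (big_pred1 [` z0]%fset) => [|m']; first exact: fB.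
  by rewrite [RHS]/= -(inj_eq val_inj).
rewrite big_pred0// => m'; apply/negP => /eqP m'0; apply: z0.
by rewrite -m'0; exact: valP.
Qed.

(** Each free coordinate contributes at most [Z] inside the support and at most 1 outside. If m is
    nonzero, s belongs to the support but its coordinate is fixed, so one factor of [Z ^+ #|u|] is
    replaced by [decay x m]. *)
Lemma marginal_le x s F (beta : {fset nat} -> R) (m : F) (Z := 2 * zeta x) :
  1 < x -> (forall u, 0 <= beta u) ->
  \sum_(h : {ffun 'I_s.+1 -> F} | h ord_max == m) amp x beta (fext h) <=
  if val m == 0
  then \sum_(u <- fpowerset (coords 0 s.+1) | s \notin u) beta u * Z ^+ #|` u|
  else decay x (val m) *
    ((\sum_(u <- fpowerset (coords 0 s.+1) | s \in u) beta u * Z ^+ #|` u|) / Z).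
Proof.
move=> x1 b0; have Z0 : 0 < Z by rewrite mulr_gt0// (lt_le_trans ltr01)// zeta_ge1.
(* A factor that vanishes unless the last coordinate is [m] encodes the constraint inside the
   product. *)
pose G (j : 'I_s.+1) (m' : F) : R :=
  if j == ord_max then if m' == m then decay x (val m') else 0 else decay x (val m').
rewrite big_mkcond [leLHS](_ : _ =
  \sum_(h : {ffun 'I_s.+1 -> F}) beta (supp (fext h)) * \prod_j G j (h j)); last first.
  apply: eq_bigr => h _; rewrite /amp big_ord_recr [in RHS]big_ord_recr/= /G eqxx.
  rewrite ffunE; case: (eqVneq (h ord_max) m) => _; last by rewrite !mulr0.
  congr (_ * (_ * _)); apply: eq_bigr => j _; rewrite ffunE ifF//.
  by apply/negP => /eqP/(congr1 val)/= js; have := ltn_ord j; rewrite js ltnn.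
rewrite sum_by_supp.
have H u : u \in fpowerset (coords 0 s.+1) ->
    beta u * \prod_(j < s.+1) \sum_(m' : F | (val m' != 0) == (val j \in u)) G j m' <=
    if (val m != 0) == (s \in u) then beta u * (\prod_(j < s) (if val j \in u then Z else 1)
      * decay x (val m)) else 0.
  rewrite fpowersetE => us; rewrite big_ord_recr/=.
  have -> : \sum_(m' : F | (val m' != 0) == (s \in u)) G ord_max m' =
      if (val m != 0) == (s \in u) then decay x (val m) else 0.
    rewrite /G eqxx -big_mkcondr/= big_mkcond (bigD1 m)//= eqxx andbT big1 ?addr0//.
    by move=> m' /negPf ->; rewrite andbF.
  case: ifP => _; last by rewrite !mulr0.
  apply: ler_wpM2l => //; apply: ler_wpM2r; first exact: decay_ge0.
  apply: ler_prod => j _.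
  have jG : \sum_(m' : F | (val m' != 0) == (val j \in u)) G (widen_ord (leqnSn s) j) m' =
      \sum_(m' : F | (val m' != 0) == (val j \in u)) decay x (val m').
    apply: eq_bigr => m' _; rewrite /G ifF//.
    by apply/negP => /eqP/(congr1 val)/= js; have := ltn_ord j; rewrite js ltnn.
  rewrite jG sumr_ge0/=; last by move=> ? _; exact: decay_ge0.
  case: ifP => ju.
    by under eq_bigl do rewrite eqb_id; exact: sum_decay_le.
  under eq_bigl do rewrite eqbF_neg negbK.
  by apply: sum_zero_le => // m' /eqP ->; rewrite /decay eqxx.
have pZ u : (u `<=` coords 0 s.+1)%fset ->
    \prod_(j < s) (if val j \in u then Z else 1) = if s \in u then Z ^+ #|` u| / Z else Z ^+ #|` u|.
  move=> us; rewrite -(prod_mem_coords Z us) big_ord_recr/=.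
  by case: (s \in u); rewrite ?mulr1// mulfK// lt0r_neq0.
rewrite big_seq; apply: le_trans (ler_sum _ H) _; rewrite -big_seq.
rewrite le_eqVlt; apply/orP; left; apply/eqP; case: ifPn => [/eqP ->|m0].
  rewrite [RHS]big_mkcond big_seq [RHS]big_seq; apply: eq_bigr => u.
  rewrite fpowersetE => us; rewrite pZ// /decay eqxx mulr1/=.
  by case: (s \in u).
rewrite mulr_suml mulr_sumr [RHS]big_mkcond big_seq [RHS]big_seq; apply: eq_bigr => u.
rewrite fpowersetE => us; rewrite pZ//.
by case: (s \in u) => //=; ring.
Qed.

(* The weight n | k_s - h_s, or else 1/(n-1), bounds the proportion of the
   z_s in {1, ..., n-1} for which k - h is in the dual lattice. *)
Definition kappa (n : nat) (t : int) : R := (n%:Z %| t)%Z%:R + n.-1%:R^-1.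

Lemma kappa_ge0 n t : 0 <= kappa n t.
Proof. by rewrite addr_ge0// invr_ge0. Qed.

(** After summing over all other coordinates only the two last ones, m and m', remain. They cannot
    both be 0. If exactly one is 0, the sum of [kappa] times [decay] over the other is at most
    (n^(-x) + 1/(n-1)) Z <= 3 Z/n, using x > 1 and n >= 2; the two such cases give the constant 6.
    If both are nonzero, congruent pairs give 2^(x+1) and the part 1/(n-1) <= 2/n gives 2. *)
Lemma pair_sum_le x s F (beta : {fset nat} -> R) (n : nat) (t : R)
    (Z := 2 * zeta x) :
  1 < x -> (forall u, 0 <= beta u) -> (1 < n)%N -> 6 <= t ->
  2 `^ (x + 1) + 2 <= t ->
  \sum_(h : {ffun 'I_s.+1 -> F})
    \sum_(k : {ffun 'I_s.+1 -> F} | h ord_max != k ord_max)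
      kappa n (val (k ord_max) - val (h ord_max)) *
        (amp x beta (fext h) * amp x beta (fext k)) <=
  t / n%:R
    * (\sum_(u <- fpowerset (coords 0 s.+1) | s \in u) beta u * Z ^+ #|` u|)
    * (\sum_(u <- fpowerset (coords 0 s.+1)) beta u * Z ^+ #|` u|).
Proof.
move=> x1 b0 n1 t6 tx; have Z0 : 0 < Z by rewrite mulr_gt0// (lt_le_trans ltr01)// zeta_ge1.
have n0 : (0 < n)%N by exact: ltnW.
rewrite [X in _ <= _ * X](bigID (fun u : {fset nat} => s \in u))/=.
set P := \sum_(u <- _ | s \in u) _; set Q := \sum_(u <- _ | s \notin u) _.
have P0 : 0 <= P by apply: sumr_ge0 => u _; rewrite mulr_ge0// exprn_ge0// ltW.
have Q0 : 0 <= Q by apply: sumr_ge0 => u _; rewrite mulr_ge0// exprn_ge0// ltW.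
pose B (m : F) : R := if val m == 0 then Q else decay x (val m) * (P / Z).
have B0 m : 0 <= B m.
  by rewrite /B; case: ifP => // _; rewrite mulr_ge0 ?decay_ge0// divr_ge0// ltW.
apply: (@le_trans _ _ (\sum_(m : F) \sum_(m' : F | m != m')
    kappa n (val m' - val m) * (B m * B m'))).
  rewrite (partition_big (fun h : {ffun 'I_s.+1 -> F} => h ord_max) xpredT)//=.
  apply: ler_sum => m _.
  under eq_bigr => h /eqP hm.
    rewrite (partition_big (fun k : {ffun 'I_s.+1 -> F} => k ord_max) (fun m' => m != m'))/=; last first.
      by move=> k; rewrite hm.
    under eq_bigr => m' mm'.
      rewrite (eq_bigl (fun k : {ffun 'I_s.+1 -> F} => k ord_max == m')); last first.
        by move=> k; rewrite hm; case: (eqVneq (k ord_max) m') => [->|_]; rewrite ?mm' ?andbF.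
      under eq_bigr => k /eqP km do rewrite hm km.
      rewrite -mulr_sumr -mulr_sumr.
      over.
    over.
  rewrite exchange_big/=; apply: ler_sum => m' _.
  rewrite -mulr_sumr -mulr_suml; apply: ler_wpM2l; first exact: kappa_ge0.
  by apply: ler_pM; rewrite ?marginal_le//; apply: sumr_ge0 => h _; exact: amp_ge0.
have nR : 0 < n%:R :> R by rewrite ltr0n.
have K1 : n%:R `^ (- x) <= n%:R^-1 :> R.
  rewrite -[leRHS]powR_inv1// ler_powR ?ler1n//; lra.
have K2 : n.-1%:R^-1 <= 2 / n%:R :> R.
  have nR1 : 0 < n.-1%:R :> R by rewrite ltr0n -ltnS prednK.
  rewrite ler_pdivlMr// ler_pdivrMl// -natrM ler_nat.
  by case: (n) n1 => [//|[//|k]] _ /=; rewrite muln2 -addnn addnS ltnS leq_addr.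
have PZ : P / Z * Z = P by rewrite divfK// lt0r_neq0.
have PZQ : Z * (P / Z * Q) = P * Q by rewrite -[in RHS]PZ; ring.
have sum1 : \sum_(m : F | val m != 0) kappa n (val m) * decay x (val m) <=
    3 / n%:R * Z.
  under eq_bigr do rewrite mulrDl.
  rewrite big_split/= -mulr_sumr.
  have -> : 3 / n%:R * Z = n%:R^-1 * Z + 2 / n%:R * Z by ring.
  apply: lerD.
    apply: le_trans (ler_wpM2r (ltW Z0) K1).
    apply: le_trans (sum_decay_dvd_le F x1 n0).
    rewrite [leRHS]big_mkcondr/=; apply: ler_sum => m m0.
    by case: (_ %| _)%Z; rewrite ?mul1r ?mul0r.
  apply: ler_pM; rewrite ?invr_ge0// ?sum_decay_le//.
  by apply: sumr_ge0 => m _; exact: decay_ge0.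
have kN m : kappa n (- m) = kappa n m by rewrite /kappa rpredN.
rewrite (bigID (fun m : F => val m == 0))/=.
(* The last coordinate of h is 0, hence that of k is not. *)
have T1 : \sum_(m : F | val m == 0) \sum_(m' : F | m != m')
    kappa n (val m' - val m) * (B m * B m') <= 3 / n%:R * (P * Q).
  apply: sum_zero_le => [|m m0]; first by rewrite !mulr_ge0// invr_ge0.
  apply: (@le_trans _ _ ((\sum_(m' : F | val m' != 0) kappa n (val m') * decay x (val m'))
      * (P / Z * Q))).
    rewrite mulr_suml le_eqVlt; apply/orP; left; apply/eqP.
    apply: eq_big => [m'|m' mm']; first by rewrite -(inj_eq val_inj) (eqP m0) eq_sym.
    move: mm'; rewrite -(inj_eq val_inj) /B m0 (eqP m0) subr0 eq_sym => /negPf ->.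
    by ring.
  apply: le_trans (ler_wpM2r _ sum1) _; first by rewrite mulr_ge0// divr_ge0// ltW.
  by rewrite -[leLHS]mulrA PZQ.
(* The last coordinate of h is nonzero: the first summand on the right bounds the case where that of
   k is 0, the second the case where neither is. *)
have T2 : \sum_(m : F | val m != 0) \sum_(m' : F | m != m')
    kappa n (val m' - val m) * (B m * B m') <=
    3 / n%:R * (P * Q) + (2 `^ (x + 1) + 2) / n%:R * (P * P).
  under eq_bigr do rewrite (bigID (fun m' : F => val m' == 0))/=.
  rewrite big_split/=; apply: lerD.
    apply: (@le_trans _ _ ((\sum_(m : F | val m != 0) kappa n (val m) * decay x (val m))
      * (P / Z * Q))).
      rewrite mulr_suml; apply: ler_sum => m m0.
      rewrite (eq_bigl (fun m' : F => val m' == 0)); last first.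
        move=> m'/=; case: eqVneq => [<-|]//=.
        by rewrite (negPf m0).
      apply: sum_zero_le => [|m' m'0].
        by rewrite !mulr_ge0 ?kappa_ge0 ?decay_ge0 ?invr_ge0// ltW.
      by rewrite /B m'0 (negPf m0) (eqP m'0) sub0r kN le_eqVlt; apply/orP; left; apply/eqP; ring.
    apply: le_trans (ler_wpM2r _ sum1) _; first by rewrite mulr_ge0// divr_ge0// ltW.
    by rewrite -[leLHS]mulrA PZQ.
  apply: (@le_trans _ _ (P / Z * (P / Z) * (2 `^ (x + 1) * n%:R `^ (- x) * Z ^+ 2
      + 2 / n%:R * Z ^+ 2))); last first.
    have -> : P / Z * (P / Z) * (2 `^ (x + 1) * n%:R `^ (- x) * Z ^+ 2 + 2 / n%:R * Z ^+ 2)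
       = (2 `^ (x + 1) * n%:R `^ (- x) + 2 / n%:R) * (P * P).
      by rewrite -[in RHS]PZ; ring.
    apply: ler_wpM2r; first by rewrite mulr_ge0.
    by rewrite [leRHS]mulrDl lerD2r ler_wpM2l// powR_ge0.
  (* The two summands of [kappa] are separated. The condition m != m' is kept only with the
     congruence; without it, the part with 1/(n-1) is a full product of sums. *)
  apply: (@le_trans _ _ (P / Z * (P / Z) *
    (\sum_(m : F | val m != 0) \sum_(m' : F | [&& val m' != 0, m != m' &
      (n%:Z %| val m' - val m)%Z]) decay x (val m) * decay x (val m')
     + \sum_(m : F | val m != 0) \sum_(m' : F | val m' != 0)
       n.-1%:R^-1 * (decay x (val m) * decay x (val m'))))).
    rewrite -big_split mulr_sumr; apply: ler_sum => m m0/=.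
    rewrite big_mkcond [X in _ <= _ * (X + _)]big_mkcond [X in _ <= _ * (_ + X)]big_mkcond/=.
    rewrite -big_split mulr_sumr; apply: ler_sum => m' _/=.
    have d0 := mulr_ge0 (decay_ge0 x (fsval m)) (decay_ge0 x (fsval m')).
    have p0 : 0 <= P / Z * (P / Z) by rewrite mulr_ge0// divr_ge0// ltW.
    have i0 : 0 <= n.-1%:R^-1 :> R by rewrite invr_ge0.
    rewrite andbC; case m'0 : (fsval m' != 0) => /=; last by rewrite addr0 mulr0.
    have m'0' := negbTE m'0; case: ifP => mm'; last by rewrite andFb add0r; apply: mulr_ge0 => //; exact: mulr_ge0.
    rewrite /B (negPf m0) m'0' /kappa andTb; case: (_ %| _)%Z => /=;
      rewrite le_eqVlt; apply/orP; left; apply/eqP; ring.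
  apply: ler_wpM2l; first by rewrite mulr_ge0// divr_ge0// ltW.
  apply: lerD; first exact: sum_decay_pair_le.
  under eq_bigr do (rewrite -mulr_sumr -mulr_sumr mulrCA).
  rewrite -mulr_suml mulrCA expr2; apply: ler_pM => //; rewrite ?invr_ge0//.
    by rewrite mulr_ge0// sumr_ge0// => m _; exact: decay_ge0.
  by apply: ler_pM; rewrite ?sum_decay_le// sumr_ge0// => m _; exact: decay_ge0.
apply: le_trans (lerD T1 T2) _.
have -> : 3 / n%:R * (P * Q) + (3 / n%:R * (P * Q) + (2 `^ (x + 1) + 2) / n%:R * (P * P))
  = (6 * (P * Q) + (2 `^ (x + 1) + 2) * (P * P)) / n%:R by ring.
have -> : t / n%:R * P * (P + Q) = (t * (P * Q) + t * (P * P)) / n%:R by ring.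
rewrite ler_wpM2r ?invr_ge0//; apply: lerD; apply: ler_wpM2r => //; exact: mulr_ge0.
Qed.

End support_sums.

(** * Averaging over the candidates of one CBC step *)

Section esum_truncation.
Context (R : realType).

Lemma sum_subset_le (T : eqType) (r1 r2 : seq T) (a : T -> R) :
  uniq r1 -> uniq r2 -> {subset r1 <= r2} -> (forall i, 0 <= a i) ->
  \sum_(i <- r1) a i <= \sum_(i <- r2) a i.
Proof.
move=> u1 u2 r12 a0; rewrite [leRHS](bigID (mem r1))/=.
rewrite -[X in _ <= X + _]big_filter [X in _ <= X + _](perm_big r1); last first.
  apply: uniq_perm; rewrite ?filter_uniq// => i; rewrite mem_filter.
  by case: (boolP (i \in r1)) => //= /r12.
by rewrite lerDl sumr_ge0.
Qed.

Lemma esum_le_fset (T : choiceType) (D : set T) (a : T -> \bar R) (B : \bar R) :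
  (forall A : {fset T}, (forall i, i \in A -> D i) ->
     (\sum_(i <- A) a i <= B)%E) ->
  (\esum_(i in D) a i <= B)%E.
Proof.
move=> h; apply: ge_ereal_sup => _ [X [fX XD] <-]; rewrite fsbig_finite//=.
by apply: h => i; rewrite in_fset_set// inE; exact: XD.
Qed.

Lemma sum_le_esum (T : choiceType) (D : set T) (r : seq T) (a : T -> \bar R) :
  uniq r -> (forall i, i \in r -> D i) ->
  (\sum_(i <- r) a i <= \esum_(i in D) a i)%E.
Proof.
move=> ur rD; apply: esum_ge; exists [set` r]; last by rewrite -fsbig_seq.
by split => //; exact: finite_seq.
Qed.

Variable s : nat.
Local Notation freq := {ffun 'I_s -> int}.
Variables (P : rel freq) (g : freq -> freq -> R).
Hypothesis g0 : forall h k, 0 <= g h k.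

(** The substitution k = h + l turns frequency and dual vector into a pair of frequencies, in which
    both factors of the summand play the same role. *)
Lemma esum_shift :
  (\esum_(h in [set: freq]) \esum_(l in [set l | P h (h + l)%R]) (g h (h + l)%R)%:E =
  \esum_(p in [set p : freq * freq | P p.1 p.2]) (g p.1 p.2)%:E)%E.
Proof.
under eq_esum => h _.
  rewrite -(@reindex_esum _ _ _ [set l | P h (h + l)%R] [set k | P h k] (fun l => h + l)
    (fun k => (g h k)%:E)); last first.
    split => //.
      by move=> l l' _ _ /addrI.
    by move=> k Pk; exists (k - h); rewrite /= addrC subrK.
  over.
rewrite esum_esum => [|h k _ _]; last by rewrite lee_fin.
by congr esum; apply/seteqP; split=> -[h k] //= [].
Qed.

Lemma sum_trunc_le_esum (F : {fset int}) :
  ((\sum_(h : {ffun 'I_s -> F}) \sum_(k : {ffun 'I_s -> F} | P (fext h) (fext k))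
     g (fext h) (fext k))%:E <=
   \esum_(h in [set: freq]) \esum_(l in [set l | P h (h + l)%R]) (g h (h + l)%R)%:E)%E.
Proof.
pose e (q : {ffun 'I_s -> F} * {ffun 'I_s -> F}) := (fext q.1, fext q.2).
have einj : injective e by move=> [h k] [h' k'] [/fext_inj -> /fext_inj ->].
rewrite esum_shift pair_big_dep/= -(big_map e (fun p => P p.1 p.2) (fun p => g p.1 p.2)).
rewrite -sumEFin -big_filter; apply: sum_le_esum.
  by rewrite filter_uniq// map_inj_uniq// index_enum_uniq.
by move=> p; rewrite mem_filter => /andP[].
Qed.

(** A finite set of pairs involves finitely many integers; with all of them collected in [F], its
    sum is part of the truncated sum over [F]. A bound uniform in [F] is thus a bound on the whole
    sum. *)
Lemma esum_le_trunc (B : \bar R) :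
  (forall F : {fset int},
    ((\sum_(h : {ffun 'I_s -> F}) \sum_(k : {ffun 'I_s -> F} | P (fext h) (fext k))
     g (fext h) (fext k))%:E <= B)%E) ->
  (\esum_(h in [set: freq]) \esum_(l in [set l | P h (h + l)%R]) (g h (h + l)%R)%:E <= B)%E.
Proof.
move=> h; rewrite esum_shift; apply: esum_le_fset => A AP.
pose F : {fset int} :=
  [fset m in flatten [seq codom p.1 ++ codom p.2 | p : freq * freq <- A]]%fset.
have memF (p : freq * freq) : p \in A -> forall j, p.1 j \in F /\ p.2 j \in F.
  move=> pA j; rewrite !inE; split; apply/flatten_mapP; exists p => //;
    by rewrite mem_cat codom_f// orbT.
apply: le_trans (h F).
pose e (q : {ffun 'I_s -> F} * {ffun 'I_s -> F}) := (fext q.1, fext q.2).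
have einj : injective e by move=> [h1 k] [h' k'] [/fext_inj -> /fext_inj ->].
rewrite pair_big_dep/= -(big_map e (fun p => P p.1 p.2) (fun p => g p.1 p.2)).
rewrite sumEFin lee_fin -[leRHS]big_filter; apply: sum_subset_le => //.
- exact: fset_uniq.
- by rewrite filter_uniq// map_inj_uniq// index_enum_uniq.
- move=> p pA; rewrite mem_filter AP//=.
  pose q : {ffun 'I_s -> F} * {ffun 'I_s -> F} :=
    ([ffun j => [` (memF p pA j).1]%fset], [ffun j => [` (memF p pA j).2]%fset]).
  have -> : p = e q.
    by rewrite [LHS]surjective_pairing; congr pair; apply/ffunP => j; rewrite !ffunE.
  by apply: map_f; rewrite mem_index_enum.
Qed.

End esum_truncation.

(** * Dual candidates and powers of theta_s *)

Section theta_bounds.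
Context (R : realType).
Implicit Types (u w : {fset nat}) (z : seq nat).

(** Boolean form of [dual_lattice], usable as a filter in finite sums and as a numerical
    indicator. *)
Definition dualb (n s : nat) z (l : {ffun 'I_s -> int}) : bool :=
  (n%:Z %| \sum_(j < s) l j * (nth 0%N z j)%:Z)%Z.

Lemma sum_at_most_one (T : eqType) (r : seq T) (b : pred T) : uniq r ->
  {in r &, forall c c', b c -> b c' -> c = c'} ->
  \sum_(c <- r) (b c)%:R <= 1 :> R.
Proof.
move=> ur b1; have [|nb] := boolP (has b r); last first.
  rewrite big_seq big1 ?ler01// => c cr; case bc : (b c) => //.
  by case/hasP: nb; exists c.
case/hasP => c cr bc; rewrite (bigD1_seq c)//= bc big_seq_cond big1 ?addr0// => c'.
by case/andP => c'r /eqP c'c; case bc' : (b c') => //; have := b1 _ _ c'r cr bc' bc.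
Qed.

(** Two dual candidates c < c' would give n | l_s (c' - c) with 0 < c' - c < n; as n is prime, this
    forces n | l_s. Without that divisibility at most one of the n - 1 candidates counts, which is
    the second summand of [kappa]. *)
Lemma sum_dual_le (n s : nat) z (l : {ffun 'I_s.+1 -> int}) :
  prime n -> size z = s ->
  \sum_(1 <= c < n) (dualb n (rcons z c) l)%:R <= n.-1%:R * kappa R n (l ord_max).
Proof.
move=> pn zs; have n1 := prime_gt1 pn.
have n1R : n.-1%:R != 0 :> R by rewrite pnatr_eq0 -lt0n -ltnS prednK// ltnW.
rewrite /kappa mulrDr divff//; case: (boolP (_ %| _)%Z) => [_|nl].
  rewrite mulr1; apply: le_trans (_ : n.-1%:R <= _); last by rewrite lerDl.
  apply: (@le_trans _ _ (\sum_(1 <= c < n) 1%:R)).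
    by apply: ler_sum => c _; rewrite ler_nat leq_b1.
  by rewrite -natr_sum sum_nat_const_nat muln1 subn1.
rewrite mulr0 add0r; apply: sum_at_most_one; first exact: iota_uniq.
have dE c : dualb n (rcons z c) l = (n%:Z %|
    \sum_(j < s) l (widen_ord (leqnSn s) j) * (nth 0%N z j)%:Z + l ord_max * c%:Z)%Z.
  rewrite /dualb big_ord_recr/= nth_rcons zs ltnn eqxx; congr (_ %| _ + _)%Z.
  by apply: eq_bigr => j _; rewrite nth_rcons zs ltn_ord.
have half c c' : (0 < c <= c')%N -> (c' < n)%N -> dualb n (rcons z c) l ->
    dualb n (rcons z c') l -> c = c'.
  rewrite !dE => /andP[c0 cc'] c'n dc dc'.
  have : (n%:Z %| l ord_max * (c' - c)%N%:Z)%Z.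
    have := rpredB dc' dc.
    by rewrite opprD addrACA subrr add0r -mulrBr -subzn.
  rewrite dvdzE abszM Euclid_dvdM//= => /orP[|].
    by rewrite -[(_ %| _)%N]/((n%:Z %| l ord_max)%Z) (negPf nl).
  have [cc _|] := posnP (c' - c)%N.
    by apply/eqP; rewrite eqn_leq cc' -subn_eq0 cc.
  move=> cc /(dvdn_leq cc); rewrite leqNgt => /negP[].
  by apply: leq_ltn_trans c'n; exact: leq_subr.
move=> c c'; rewrite !mem_index_iota => /andP[c0 cn] /andP[c'0 c'n] dc dc'.
by have [cc'|/ltnW cc'] := leqP c c'; [|apply/esym]; apply: half => //; rewrite ?c0 ?c'0.
Qed.

Variable alpha : R.

Lemma rprime_decay s (h : {ffun 'I_s -> int}) :
  (rprime alpha h)^-1 = \prod_j decay alpha (h j).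
Proof.
rewrite /rprime -prodfV big_mkcond; apply: eq_bigr => j _.
by rewrite /decay; case: eqP => //= _; rewrite powRN.
Qed.

(** Where the weight vanishes, both sides are +oo. *)
Lemma rfunE s (gamma : {fset nat} -> R) (h : {ffun 'I_s -> int}) :
  rfun alpha gamma h = ((amp alpha gamma h)%:E^-1)%E.
Proof.
rewrite /rfun /amp -rprime_decay.
have r0 : 0 < rprime alpha h.
  by apply: prodr_gt0 => j hj; rewrite powR_gt0// normr_gt0 intr_eq0.
have [->|gn] := eqVneq (gamma (supp h)) 0.
  by rewrite mul0r inve0 gt0_muley ?lte_fin.
by rewrite !inver mulf_eq0 invr_eq0 (negPf gn) (gt_eqF r0)/= invfM invrK mulrC.
Qed.

Lemma rfunV s (gamma : {fset nat} -> R) (h : {ffun 'I_s -> int}) :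
  ((rfun alpha gamma h)^-1 = (amp alpha gamma h)%:E)%E.
Proof. by rewrite rfunE inveK. Qed.

Lemma S_crit_ge0 n d (z : d.-tuple nat) (gamma : {fset nat} -> R) :
  (forall u, 0 <= gamma u) -> (0 <= S_crit alpha gamma n z)%E.
Proof.
move=> g0; apply: esum_ge0 => h _; rewrite rfunV mule_ge0 ?lee_fin ?amp_ge0//.
by apply: esum_ge0 => l _; rewrite rfunV lee_fin amp_ge0.
Qed.

(** With k = h + l, the condition l_s != 0 says that h and k differ in the last coordinate. *)
Lemma thetaE n s z (beta : {fset nat} -> R) : (forall u, 0 <= beta u) ->
  theta alpha n s.+1 z beta =
  (\esum_(p in [set p : {ffun 'I_s.+1 -> int} * {ffun 'I_s.+1 -> int} |
      p.1 ord_max != p.2 ord_max /\ dualb n z (p.2 - p.1)%R])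
    (amp alpha beta p.1 * amp alpha beta p.2)%:E)%E.
Proof.
move=> b0.
pose P (h k : {ffun 'I_s.+1 -> int}) := (h ord_max != k ord_max) && dualb n z (k - h).
transitivity (\esum_(p in [set p | P p.1 p.2]) (amp alpha beta p.1 * amp alpha beta p.2)%:E)%E; last first.
  by congr esum; apply/seteqP; split=> p /=; [case/andP|case=> ? ?; apply/andP].
have g0 h k : 0 <= amp alpha beta (h : {ffun 'I_s.+1 -> int}) * amp alpha beta (k : {ffun 'I_s.+1 -> int}).
  by rewrite mulr_ge0// amp_ge0.
rewrite -(esum_shift P g0) /theta; apply: eq_esum => h _.
rewrite (_ : [set _ | _] = [set l | P h (h + l)]).
  by apply: eq_esum => l _; rewrite /amp -!rprime_decay.
apply/seteqP; split=> l /=; have sl : (s \in supp l) = (l ord_max != 0) := mem_supp l ord_max;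
  rewrite /P /dual_lattice/= addrAC subrr add0r.
  rewrite sl ffunE => -[l0 dl]; apply/andP; split => //.
  by rewrite -subr_eq0 opprD addNKr oppr_eq0.
rewrite sl ffunE => /andP[l0 dl]; split => //.
by move: l0; rewrite -subr_eq0 opprD addNKr oppr_eq0.
Qed.

Lemma lee_poweR (x y : \bar R) (p : R) : 0 <= p -> (0 <= x)%E -> (x <= y)%E ->
  (x `^ p <= y `^ p)%E.
Proof.
move=> p0 x0 xy; apply: (gt0_ler_poweR p0) => //; rewrite in_itv/= leey andbT//.
exact: le_trans xy.
Qed.

(** With the root [p^-1] taken on the right, only finite subsums of the left side have to be
    bounded, and Jensen's inequality for finite sums applies to them. *)
Lemma esum_poweR_le (T : choiceType) (D : set T) (a : T -> R) (p : R) :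
  0 < p <= 1 -> (forall i, 0 <= a i) ->
  ((\esum_(i in D) (a i)%:E) `^ p <= \esum_(i in D) (a i `^ p)%:E)%E.
Proof.
move=> /andP[p0 p1] a0.
have e0 : (0 <= \esum_(i in D) (a i `^ p)%:E)%E.
  by apply: esum_ge0 => i _; rewrite lee_fin powR_ge0.
have e0' : (0 <= \esum_(i in D) (a i)%:E)%E.
  by apply: esum_ge0 => i _; rewrite lee_fin.
suff h : (\esum_(i in D) (a i)%:E <= (\esum_(i in D) (a i `^ p)%:E) `^ p^-1)%E.
  apply: le_trans (lee_poweR (ltW p0) e0' h) _.
  by rewrite -poweRrM mulVf ?lt0r_neq0// poweRe1.
apply: esum_le_fset => A AD.
have h : ((\sum_(i <- A) a i `^ p)%:E <= \esum_(i in D) (a i `^ p)%:E)%E.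
  by rewrite -sumEFin; apply: sum_le_esum => //; exact: fset_uniq.
have s0 : 0 <= \sum_(i <- A) a i by exact: sumr_ge0.
have s0' : 0 <= \sum_(i <- A) a i `^ p by apply: sumr_ge0 => i _; exact: powR_ge0.
have pV0 : 0 <= p^-1 by rewrite invr_ge0 ltW.
apply: le_trans (lee_poweR pV0 _ h); rewrite ?lee_fin//.
rewrite sumEFin poweR_EFin lee_fin.
rewrite -[leLHS]powRr1// -(mulfV (lt0r_neq0 p0)) powRrM.
apply: ge0_ler_powR; rewrite ?nnegrE ?powR_ge0 ?invr_ge0 ?(ltW p0)//.
by apply: powR_sum_le; rewrite ?p0.
Qed.

Lemma poweR_sum_le (I : Type) (r : seq I) (F : I -> \bar R) p :
  0 < p <= 1 -> (forall i, (0 <= F i)%E) ->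
  ((\sum_(i <- r) F i) `^ p <= \sum_(i <- r) F i `^ p)%E.
Proof.
move=> /andP[p0 p1] F0; elim: r => [|i r IH].
  by rewrite !big_nil poweR0r// gt_eqF.
rewrite !big_cons; apply: le_trans (leeD2l _ IH).
have := F0 i; have : (0 <= \sum_(j <- r) F j)%E by exact: sume_ge0.
move: (F i) (\sum_(j <- r) F j)%E => [a| |] [b| |]//= b0 a0;
  rewrite ?(gt_eqF p0)/= ?addye ?addey ?leey//.
rewrite -EFinD lee_fin.
have := @powR_sum_le R bool [:: true; false] xpredT (fun c => if c then a else b) p.
rewrite !big_cons !big_nil !addr0; apply; first by rewrite p0.
by case; rewrite -lee_fin.
Qed.

Section cbc_step.
Variables (n s d : nat) (z : seq nat) (lambda : R) (gamma : {fset nat} -> R).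
Hypotheses (pn : prime n) (zs : size z = s) (l01 : 0 < lambda <= 1)
  (al : 1 < lambda * alpha) (gamma_ge0 : forall u, 0 <= gamma u).
Let x := lambda * alpha.
Let Z := 2 * zeta x.

Lemma sum_theta_le (beta : {fset nat} -> R) (t : R) : (forall u, 0 <= beta u) ->
  6 <= t -> 2 `^ (x + 1) + 2 <= t ->
  (\sum_(1 <= c < n) theta alpha n s.+1 (rcons z c) beta `^ lambda <=
  (n.-1%:R * (t / n%:R
    * (\sum_(u <- fpowerset (coords 0 s.+1) | s \in u) beta u `^ lambda * Z ^+ #|` u|)
    * (\sum_(u <- fpowerset (coords 0 s.+1)) beta u `^ lambda * Z ^+ #|` u|)))%:E)%E.
Proof.
move=> b0 t6 tx; have bl0 u : 0 <= beta u `^ lambda by exact: powR_ge0.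
pose B u := beta u `^ lambda.
pose g (h k : {ffun 'I_s.+1 -> int}) := amp x B h * amp x B k.
have g0 h k : 0 <= g h k by rewrite mulr_ge0// amp_ge0.
have nR : 0 < n.-1%:R :> R by rewrite ltr0n -ltnS prednK ?prime_gt0// prime_gt1.
(* The dual lattice condition becomes an indicator in the summand, so that the index set no longer
   depends on c and the sum over c can be taken inside. *)
have step c : (theta alpha n s.+1 (rcons z c) beta `^ lambda <=
   \esum_(p in [set p : {ffun 'I_s.+1 -> int} * {ffun 'I_s.+1 -> int} |
      p.1 ord_max != p.2 ord_max])
     ((dualb n (rcons z c) (p.2 - p.1)%R)%:R * g p.1 p.2)%:E)%E.
  rewrite thetaE//; apply: le_trans (esum_poweR_le _ l01 _) _.
    by move=> p; rewrite mulr_ge0// amp_ge0.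
  rewrite (_ : [set _ | _] = [set p : {ffun 'I_s.+1 -> int} * {ffun 'I_s.+1 -> int} |
      p.1 ord_max != p.2 ord_max] `&` [set p | dualb n (rcons z c) (p.2 - p.1)])//.
  rewrite esum_mkcondr; apply: le_esum => p _.
  case: ifPn => [/set_mem/= ->|_]; last by rewrite lee_fin mulr_ge0.
  rewrite mul1r lee_fin powRM ?amp_ge0//.
  by rewrite !amp_powR.
apply: le_trans (lee_sum _ (fun c _ => step c)) _.
rewrite -esum_sum; last by move=> p c _ _; rewrite lee_fin mulr_ge0.
pose P (h k : {ffun 'I_s.+1 -> int}) := h ord_max != k ord_max.
pose G (h k : {ffun 'I_s.+1 -> int}) :=
  n.-1%:R * (kappa R n (k ord_max - h ord_max) * g h k).
have G0 h k : 0 <= G h k.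
  by apply: mulr_ge0; [exact: ltW|apply: mulr_ge0 => //; exact: kappa_ge0].
apply: (@le_trans _ _ (\esum_(p in [set p | P p.1 p.2]) (G p.1 p.2)%:E)%E).
  apply: le_esum => p _; rewrite sumEFin lee_fin -mulr_suml /G mulrA.
  apply: ler_wpM2r => //.
  have -> : p.2 ord_max - p.1 ord_max = (p.2 - p.1) ord_max by rewrite !ffunE.
  exact: sum_dual_le.
rewrite -esum_shift//; apply: esum_le_trunc => // F; rewrite lee_fin.
under eq_bigr do rewrite -mulr_sumr.
rewrite -mulr_sumr; apply: ler_wpM2l; first exact: ltW.
have := @pair_sum_le R x s F B n t al bl0 (prime_gt1 pn) t6 tx.
apply: le_trans; apply: ler_sum => h _; rewrite le_eqVlt; apply/orP; left; apply/eqP.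
by apply: eq_big => k; rewrite /P !ffunE// (inj_eq val_inj).
Qed.

Lemma cbc_T_le (c0 : nat) (t : R) :
  6 <= t -> 2 `^ (x + 1) + 2 <= t ->
  (forall c : nat, (1 <= c <= n.-1)%N ->
     (T_crit alpha gamma n d s.+1 (rcons z c0) <=
      T_crit alpha gamma n d s.+1 (rcons z c))%E) ->
  (T_crit alpha gamma n d s.+1 (rcons z c0) `^ lambda <=
  (\sum_(w <- fpowerset (coords s.+1 d)) Z ^+ #|` w| * (t / n%:R
    * (\sum_(u <- fpowerset (coords 0 s.+1) | s \in u)
         gamma (u `|` w)%fset `^ lambda * Z ^+ #|` u|)
    * (\sum_(u <- fpowerset (coords 0 s.+1))
         gamma (u `|` w)%fset `^ lambda * Z ^+ #|` u|)))%:E)%E.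
Proof.
move=> t6 tx Tmin; set T := T_crit _ _ _ _ _ _.
have nR : 0 < n.-1%:R :> R by rewrite ltr0n -ltnS prednK ?prime_gt0// prime_gt1.
have a1 : 1 < alpha.
  have /andP[l0 l1] := l01.
  by apply: (lt_le_trans al); rewrite ler_piMl// ltW// -(pmulr_rgt0 _ l0) (lt_trans ltr01).
have Z2 : 0 <= 2 * zeta (2 * alpha).
  by rewrite mulr_ge0// (le_trans ler01)// zeta_ge1//; lra.
have th0 w c : (0 <= theta alpha n s.+1 (rcons z c) (fun u => gamma (u `|` w)%fset))%E.
  apply: esum_ge0 => h _; apply: esum_ge0 => l _; rewrite lee_fin.
  by rewrite !mulr_ge0// rprime_decay prodr_ge0// => j _; exact: decay_ge0.
have T0 c : (0 <= T_crit alpha gamma n d s.+1 (rcons z c))%E.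
  by apply: sume_ge0 => w _; rewrite mule_ge0// lee_fin exprn_ge0.
have l0 : 0 <= lambda by case/andP: l01 => /ltW.
set B := (X in (_ <= X%:E)%E).
(* The minimum, taken n - 1 times, is compared with the sum over the candidates c; [1 <= c < n] has
   exactly n - 1 values. *)
suff h : (n.-1%:R%:E * T `^ lambda <= (n.-1%:R * B)%:E)%E.
  by move: h; rewrite EFinM lee_pmul2l.
have -> : (n.-1%:R%:E * T `^ lambda = \sum_(1 <= c < n) T `^ lambda)%E.
  by rewrite mule_natl big_const_nat subn1 iter_addr_0.
have l0' : 0 <= 2 * zeta x by rewrite mulr_ge0// (le_trans ler01)// zeta_ge1.
apply: (@le_trans _ _ (\sum_(1 <= c < n) \sum_(w <- fpowerset (coords s.+1 d))
   (Z ^+ #|` w|)%:E *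
     theta alpha n s.+1 (rcons z c) (fun u => gamma (u `|` w)%fset) `^ lambda)%E).
  rewrite big_seq_cond [leRHS]big_seq_cond; apply: lee_sum => c.
  rewrite andbT mem_index_iota => /andP[c1 cn].
  apply: le_trans (lee_poweR l0 (T0 c0) (Tmin c _)) _.
    by rewrite c1/= -ltnS prednK// ltnW// prime_gt1.
  apply: le_trans (poweR_sum_le _ l01 _) _.
    by move=> w; rewrite mule_ge0// lee_fin exprn_ge0.
  apply: lee_sum => w _; rewrite poweRM ?lee_fin ?exprn_ge0//.
  apply: lee_wpmul2r; first exact: poweR_ge0.
  (* The exponents lambda and |w| are exchanged so that [powR_zeta_le] applies to the base. *)
  rewrite poweR_EFin lee_fin -powR_mulrn// powRAC powR_mulrn ?powR_ge0//.
  by apply: lerXn2r; rewrite ?nnegrE ?powR_ge0//; exact: powR_zeta_le.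
rewrite exchange_big/= /B mulr_sumr -sumEFin; apply: lee_sum => w _.
rewrite -ge0_sume_distrr; last by move=> c _; exact: poweR_ge0.
rewrite mulrCA EFinM; apply: lee_wpmul2l; first by rewrite lee_fin exprn_ge0.
exact: sum_theta_le.
Qed.

End cbc_step.

End theta_bounds.

(** * Bounds on the error criterion *)

Section criterion_decomposition.
Context (R : realType).
Implicit Types (u w : {fset nat}) (F : {fset int}).

Lemma coordsSr (s d : nat) : (s <= d)%N ->
  coords s d.+1 = (d |` coords s d)%fset.
Proof.
move=> sd; apply/fsetP => j; rewrite in_fset1U !mem_coords ltnS.
by case: (ltngtP j d) => [jd|dj|->] //=; rewrite ?andbT ?andbF ?orbF// sd.
Qed.

Lemma notin_coords (s d : nat) : d \notin coords s d.
Proof. by rewrite mem_coords ltnn andbF. Qed.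

Lemma sum_fpowerset_coordsSr (s d : nat) (f : {fset nat} -> R) : (s <= d)%N ->
  \sum_(w <- fpowerset (coords s d.+1)) f w =
  \sum_(w <- fpowerset (coords s d)) f w +
  \sum_(w <- fpowerset (coords s d)) f (d |` w)%fset.
Proof.
move=> sd; rewrite -[X in _ = _ + X](big_map (fun w => d |` w)%fset xpredT) -big_cat.
have dN w : w \in fpowerset (coords s d) -> d \notin w.
  by rewrite fpowersetE => /fsubsetP ws; apply/negP => /ws; rewrite (negPf (notin_coords s d)).
apply/perm_big/uniq_perm; first exact: fset_uniq.
  rewrite cat_uniq fset_uniq/=; apply/andP; split.
    apply/hasPn => _ /mapP[w _ ->]; apply/negP => /dN.
    by rewrite fset1U1.
  rewrite map_inj_in_uniq ?fset_uniq// => w w' /dN dw /dN dw' ww'.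
  by rewrite -(fsetU1K dw) ww' fsetU1K.
move=> w; rewrite mem_cat !fpowersetE coordsSr//.
have sub1 v : (v `<=` d |` coords s d)%fset -> d \notin v -> (v `<=` coords s d)%fset.
  move=> /fsubsetP vs dv; apply/fsubsetP => j jv; have := vs j jv.
  by rewrite in_fset1U => /orP[/eqP jd|//]; rewrite jd (negPf dv) in jv.
apply/idP/orP => [ws|[ws|/mapP[v]]].
- have [dw|dw] := boolP (d \in w); last by left; exact: sub1.
  right; apply/mapP; exists (w `\ d)%fset; last by rewrite fsetD1K.
  rewrite fpowersetE; apply: sub1; last by rewrite !inE eqxx.
  by apply: fsubset_trans ws; exact: fsubD1set.
- by apply: fsubset_trans ws _; exact: fsubsetU1.
- by rewrite fpowersetE => vs ->; rewrite fsetUS.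
Qed.

(** The new coordinate is put last, where theta_s singles it out. *)
Definition fcons d F (h : {ffun 'I_d -> F}) (m : F) : {ffun 'I_d.+1 -> F} :=
  [ffun j => if unlift ord_max j is Some i then h i else m].

Lemma fextE d F (h : {ffun 'I_d -> F}) (j : 'I_d) : fext h j = val (h j).
Proof. exact: ffunE. Qed.

Lemma fext_subE d F (h k : {ffun 'I_d -> F}) (j : 'I_d) :
  (fext k - fext h) j = val (k j) - val (h j).
Proof. by rewrite !ffunE. Qed.

Lemma widen_lift d (i : 'I_d) : widen_ord (leqnSn d) i = lift ord_max i.
Proof. exact/val_inj/esym/lift_max. Qed.

Lemma fcons_lift d F (h : {ffun 'I_d -> F}) (m : F) (i : 'I_d) :
  fcons h m (lift ord_max i) = h i.
Proof. by rewrite ffunE liftK. Qed.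

Lemma fcons_max d F (h : {ffun 'I_d -> F}) (m : F) : fcons h m ord_max = m.
Proof. by rewrite ffunE unlift_none. Qed.

Lemma sum_fcons d F (f : {ffun 'I_d.+1 -> F} -> R) :
  \sum_(h : {ffun 'I_d.+1 -> F}) f h =
  \sum_(m : F) \sum_(h : {ffun 'I_d -> F}) f (fcons h m).
Proof.
rewrite exchange_big pair_big/=.
rewrite (reindex (fun p : {ffun 'I_d -> F} * F => fcons p.1 p.2))//=.
exists (fun h : {ffun 'I_d.+1 -> F} => ([ffun i => h (lift ord_max i)], h ord_max)).
  move=> [h m] _; rewrite fcons_max/=; congr (_, _).
  by apply/ffunP => i; rewrite ffunE fcons_lift.
move=> h _; apply/ffunP => j; rewrite ffunE/=.
by case: unliftP => [i ->|->]; rewrite ?ffunE.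
Qed.

Lemma supp_fcons d F (h : {ffun 'I_d -> F}) (m : F) :
  supp (fext (fcons h m)) =
  if val m == 0 then supp (fext h) else (supp (fext h) `|` [fset d])%fset.
Proof.
have E (j : nat) : (j \in supp (fext (fcons h m))) =
    (j \in supp (fext h)) || (j == d) && (val m != 0).
  have [jd|dj|->] := ltngtP j d.
  - rewrite -[j]/(val (Ordinal jd)) mem_supp -[val _]/(val (widen_ord (leqnSn d) (Ordinal jd))).
    by rewrite mem_supp !fextE widen_lift fcons_lift orbF.
  - rewrite orbF; apply/idP/idP => /(fsubsetP (supp_coords _)); rewrite mem_coords/=.
      by rewrite ltnS leqNgt dj.
    by rewrite ltnNge (ltnW dj).
  - rewrite -[d]/(val (@ord_max d)) mem_supp fextE fcons_max.
    case: (boolP (_ \in supp (fext h))) => //.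
    by move/(fsubsetP (supp_coords _)); rewrite mem_coords/= ltnn.
apply/fsetP => j; rewrite E; case: (val m == 0) => /=; first by rewrite andbF orbF.
by rewrite !inE andbT.
Qed.

Lemma amp_fcons x d F (beta : {fset nat} -> R) (h : {ffun 'I_d -> F}) (m : F) :
  amp x beta (fext (fcons h m)) =
  if val m == 0 then amp x beta (fext h)
  else amp x (fun u => beta (u `|` [fset d])%fset) (fext h) * decay x (val m).
Proof.
rewrite /amp supp_fcons big_ord_recr/= fextE fcons_max.
have -> : \prod_(i < d) decay x (fext (fcons h m) (widen_ord (leqnSn d) i)) =
    \prod_(i < d) decay x (fext h i).
  by apply: eq_bigr => i _; rewrite !fextE widen_lift fcons_lift.
by rewrite /=; case: (eqVneq (fsval m) 0) => [->|_]; rewrite ?mulrA// /decay eqxx !mulr1.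
Qed.

Variables (alpha : R) (n : nat) (z : seq nat).
Hypothesis alpha_gt1 : 1 < alpha.

Lemma two_alpha_gt1 : 1 < 2 * alpha.
Proof. by have := alpha_gt1; lra. Qed.

(** S_d over pairs (h, k) with k = h + l, restricted to coordinates in [F]; the weights vary in the
    recursion below. *)
Definition S_trunc d F (beta : {fset nat} -> R) : R :=
  \sum_(h : {ffun 'I_d -> F}) \sum_(k : {ffun 'I_d -> F} |
      (fext h != fext k) && dualb n z (fext k - fext h))
    amp alpha beta (fext h) * amp alpha beta (fext k).

Definition theta_trunc s F (beta : {fset nat} -> R) : R :=
  \sum_(h : {ffun 'I_s.+1 -> F}) \sum_(k : {ffun 'I_s.+1 -> F} |
      (fext h ord_max != fext k ord_max) && dualb n z (fext k - fext h))
    amp alpha beta (fext h) * amp alpha beta (fext k).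

Lemma S_trunc_ge0 d F beta : (forall u, 0 <= beta u) -> 0 <= S_trunc d F beta.
Proof.
by move=> b0; apply: sumr_ge0 => h _; apply: sumr_ge0 => k _; rewrite mulr_ge0// amp_ge0.
Qed.

Lemma dualb_fcons d F (h k : {ffun 'I_d -> F}) (m : F) :
  dualb n z (fext (fcons k m) - fext (fcons h m)) = dualb n z (fext k - fext h).
Proof.
rewrite /dualb big_ord_recr/= fext_subE !fcons_max subrr mul0r addr0; congr (_ %| _)%Z.
by apply: eq_bigr => j _; rewrite !fext_subE widen_lift !fcons_lift.
Qed.

Lemma fext_fcons_eq d F (h k : {ffun 'I_d -> F}) (m : F) :
  (fext (fcons h m) == fext (fcons k m)) = (fext h == fext k).
Proof.
apply/eqP/eqP => /ffunP hk; apply/ffunP => j.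
  by have := hk (lift ord_max j); rewrite !fextE !fcons_lift.
rewrite !fextE; case: (unliftP ord_max j) => [i ->|->]; rewrite ?fcons_max//.
by rewrite !fcons_lift -!fextE hk.
Qed.

(** Pairs with different last coordinates make up theta. For a common last coordinate m, the
    difference has last entry 0, so duality is decided in dimension d. If m = 0 the same sum in
    dimension d remains; otherwise the supports gain d and [decay alpha m] occurs twice, that is, as
    [decay (2 * alpha) m], whose sum over m is at most 2 zeta(2 alpha). *)
Lemma S_trunc_recr d F (beta : {fset nat} -> R) : (forall u, 0 <= beta u) ->
  S_trunc d.+1 F beta <= theta_trunc d F beta + S_trunc d F beta +
    2 * zeta (2 * alpha) * S_trunc d F (fun u => beta (u `|` [fset d])%fset).
Proof.
move=> b0; set T := S_trunc d F (fun u => beta (u `|` _)%fset).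
pose a (h : {ffun 'I_d.+1 -> F}) := amp alpha beta (fext h).
have a0 h : 0 <= a h by exact: amp_ge0.
pose D (h k : {ffun 'I_d.+1 -> F}) := dualb n z (fext k - fext h).
have -> : S_trunc d.+1 F beta = theta_trunc d F beta +
    \sum_(h : {ffun 'I_d.+1 -> F}) \sum_(k : {ffun 'I_d.+1 -> F} |
      [&& fext h != fext k, D h k & h ord_max == k ord_max]) a h * a k.
  rewrite -big_split; apply: eq_bigr => h _ /=.
  rewrite (bigID (fun k : {ffun 'I_d.+1 -> F} => fext h ord_max != fext k ord_max))/=.
  congr (_ + _); apply: eq_bigl => k.
    case: (eqVneq (fext h ord_max) (fext k ord_max)) => /= hk; rewrite ?andbF// andbT.
    by case: (eqVneq (fext h) (fext k)) hk => [->|//]; rewrite eqxx.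
  by rewrite negbK andbA !ffunE (inj_eq val_inj).
rewrite -addrA lerD2l sum_fcons.
have inner (m : F) : \sum_(h : {ffun 'I_d -> F}) \sum_(k : {ffun 'I_d.+1 -> F} |
      [&& fext (fcons h m) != fext k, D (fcons h m) k & fcons h m ord_max == k ord_max])
        a (fcons h m) * a k =
    if val m == 0 then S_trunc d F beta else decay (2 * alpha) (val m) * T.
  rewrite [LHS](_ : _ = \sum_(h : {ffun 'I_d -> F}) \sum_(k : {ffun 'I_d -> F} |
      (fext h != fext k) && dualb n z (fext k - fext h)) a (fcons h m) * a (fcons k m)).
    case: ifP => m0; last first.
      rewrite /T /S_trunc mulr_sumr; apply: eq_bigr => h _.
      rewrite mulr_sumr; apply: eq_bigr => k _; rewrite /a !amp_fcons m0.
      by rewrite -decay_powR powR_mulrn ?decay_ge0//; ring.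
    by apply: eq_bigr => h _; apply: eq_bigr => k _; rewrite /a !amp_fcons m0.
  apply: eq_bigr => h _; rewrite big_mkcond sum_fcons (bigD1 m)//=.
  rewrite [X in _ + X]big1 ?addr0; last first.
    move=> m' m'm; rewrite big1// => k _; rewrite !fcons_max [m == _]eq_sym (negPf m'm).
    by rewrite !andbF.
  rewrite [RHS]big_mkcond; apply: eq_bigr => k _.
  by rewrite !fcons_max eqxx andbT fext_fcons_eq /D dualb_fcons.
under eq_bigr do rewrite inner.
have T0 : 0 <= T by exact: S_trunc_ge0.
rewrite (bigID (fun m : F => val m == 0))/=; apply: lerD.
  by apply: sum_zero_le => [|m ->//]; exact: S_trunc_ge0.
rewrite (eq_bigr (fun m : F => decay (2 * alpha) (val m) * T)) => [|m /negPf ->//].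
rewrite -mulr_suml; apply: ler_wpM2r => //; exact: sum_decay_le two_alpha_gt1.
Qed.

(** Induction on d with [beta] arbitrary: the third term of the recursion changes the weights and
    yields the tails w that contain d, the second yields those that do not, and the first is the
    step s = d with empty tail. *)
Lemma S_trunc_le d F (beta : {fset nat} -> R) : (forall u, 0 <= beta u) ->
  S_trunc d F beta <= \sum_(s < d) \sum_(w <- fpowerset (coords s.+1 d))
    (2 * zeta (2 * alpha)) ^+ #|` w| * theta_trunc s F (fun u => beta (u `|` w)%fset).
Proof.
set c := 2 * zeta (2 * alpha).
have c0 : 0 <= c by rewrite mulr_ge0// (le_trans ler01)// zeta_ge1//; exact: two_alpha_gt1.
elim: d beta => [|d IH] beta b0.
  rewrite big_ord0 /S_trunc big1// => h _; rewrite big1// => k.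
  by rewrite (_ : fext h = fext k) ?eqxx//; apply/ffunP => -[].
apply: le_trans (S_trunc_recr _ _ b0) _.
rewrite big_ord_recr/= [leRHS]addrC -addrA; apply: lerD.
  have -> : coords d.+1 d.+1 = fset0.
    by apply/fsetP => j; rewrite mem_coords inE ltnS [(j <= d)%N]leqNgt andbN.
  rewrite fpowerset0 big_seq_fset1 cardfs0 expr0 mul1r le_eqVlt; apply/orP; left; apply/eqP.
  by congr theta_trunc; apply/funext => u; rewrite fsetU0.
under [leRHS]eq_bigr do rewrite sum_fpowerset_coordsSr//.
rewrite big_split/=; apply: lerD; first exact: IH.
apply: le_trans (ler_wpM2l c0 (IH _ (fun u => b0 _))) _.
rewrite mulr_sumr le_eqVlt; apply/orP; left; apply/eqP.
apply: eq_bigr => s _; rewrite mulr_sumr big_seq [RHS]big_seq; apply: eq_bigr => w.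
rewrite fpowersetE => /fsubsetP ws; rewrite cardfsU1.
have -> : d \notin w by apply/negP => /ws; rewrite (negPf (notin_coords s.+1 d)).
rewrite exprS mulrA; congr (_ * theta_trunc _ _ _); apply/funext => u.
by congr beta; rewrite -fsetUA [(w `|` _)%fset]fsetUC.
Qed.

Lemma S_crit_le d (t : d.-tuple nat) (gamma : {fset nat} -> R) :
  (forall u, 0 <= gamma u) -> t = z :> seq nat ->
  (S_crit alpha gamma n t <=
   \sum_(s < d) T_crit alpha gamma n d s.+1 (take s.+1 z))%E.
Proof.
move=> g0 tz.
have a0 s (h : {ffun 'I_s -> int}) : 0 <= amp alpha gamma h by exact: amp_ge0.
pose P (h k : {ffun 'I_d -> int}) := (h != k) && dualb n z (k - h).
apply: (@le_trans _ _ (\esum_(h in [set: {ffun 'I_d -> int}])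
   \esum_(l in [set l | P h (h + l)%R]) (amp alpha gamma h * amp alpha gamma (h + l)%R)%:E)%E).
  apply: le_esum => h _; rewrite rfunV.
  (* A positive factor is moved across the inequality by division, which brings it inside the inner
     sum; the factor 0 is treated apart. *)
  have [->|an] := eqVneq (amp alpha gamma h) 0.
    by rewrite mul0e; apply: esum_ge0 => l _; rewrite mul0r.
  have ap : 0 < amp alpha gamma h by rewrite lt_neqAle eq_sym an a0.
  rewrite -lee_pdivlMl//.
  rewrite (_ : [set _ | _] = [set l | P h (h + l)]); last first.
    apply/seteqP; split=> l /=; rewrite /P /dual_lattice/= -tz addrAC subrr add0r.
      move=> [l0 dl]; apply/andP; split => //.
      by rewrite -subr_eq0 opprD addNKr oppr_eq0.
    by move=> /andP[+ dl]; rewrite -subr_eq0 opprD addNKr oppr_eq0.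
  apply: esum_le_fset => A AP.
  rewrite lee_pdivlMl// ge0_sume_distrr; last by move=> l _; rewrite rfunV lee_fin.
  rewrite (eq_bigr (fun l => (amp alpha gamma h * amp alpha gamma (h + l)%R)%:E)); last first.
    by move=> l _; rewrite rfunV.
  by apply: sum_le_esum => //; exact: fset_uniq.
have g0' (h k : {ffun 'I_d -> int}) : 0 <= amp alpha gamma h * amp alpha gamma k.
  by rewrite mulr_ge0.
apply: (esum_le_trunc (P := P) g0') => F.
apply: (@le_trans _ _ (\sum_(s < d) \sum_(w <- fpowerset (coords s.+1 d))
    (2 * zeta (2 * alpha)) ^+ #|` w| *
    theta_trunc s F (fun u => gamma (u `|` w)%fset))%:E).
  by rewrite lee_fin; exact: S_trunc_le.
rewrite -sumEFin; apply: lee_sum => s _; rewrite -sumEFin; apply: lee_sum => w _.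
rewrite EFinM; apply: lee_wpmul2l.
  by rewrite lee_fin exprn_ge0// mulr_ge0// (le_trans ler01)// zeta_ge1//; exact: two_alpha_gt1.
have b0 u : 0 <= gamma (u `|` w)%fset by [].
rewrite thetaE//.
pose P' (h k : {ffun 'I_s.+1 -> int}) := (h ord_max != k ord_max) && dualb n z (k - h).
have g1 (h k : {ffun 'I_s.+1 -> int}) : 0 <= amp alpha (fun u => gamma (u `|` w)%fset) h *
     amp alpha (fun u => gamma (u `|` w)%fset) k by rewrite mulr_ge0// amp_ge0.
apply: le_trans (sum_trunc_le_esum P' g1 F) _.
rewrite (esum_shift P' g1) (_ : [set _ | _] = [set p : {ffun 'I_s.+1 -> int} * {ffun 'I_s.+1 -> int} |
   p.1 ord_max != p.2 ord_max /\ dualb n (take s.+1 z) (p.2 - p.1)])//.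
apply/seteqP; split=> p /=; rewrite /P' (_ : dualb n z _ = dualb n (take s.+1 z) (p.2 - p.1)).
- by case/andP.
- by congr (_ %| _)%Z; apply: eq_bigr => j _; rewrite nth_take.
- by case=> ? ?; apply/andP.
- by congr (_ %| _)%Z; apply: eq_bigr => j _; rewrite nth_take.
Qed.

End criterion_decomposition.

(** * Sums over sets of indices *)

Section subset_sums.
Context (R : realType).
Implicit Types (u v w : {fset nat}) (f : {fset nat} -> R).

Lemma sum_fpowerset_split (s d : nat) f : (s <= d)%N ->
  \sum_(w <- fpowerset (coords s d)) \sum_(u <- fpowerset (coords 0 s)) f (u `|` w)%fset =
  \sum_(v <- fpowerset (coords 0 d)) f v.
Proof.
move=> sd; rewrite -(subnK sd) addnC; elim: (d - s)%N f => [|k IH] f.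
  rewrite addn0 (_ : coords s s = fset0).
    by rewrite fpowerset0 big_seq_fset1; apply: eq_bigr => u _; rewrite fsetU0.
  by apply/fsetP => j; rewrite mem_coords inE; case: leqP.
rewrite addnS !sum_fpowerset_coordsSr ?leq_addr//; congr (_ + _); first exact: IH.
rewrite -(IH (fun v => f ((s + k)%N |` v)%fset)).
apply: eq_bigr => w _; apply: eq_bigr => u _; congr f.
by rewrite fsetUCA.
Qed.

(** Each nonempty set is met once, at s equal to its largest element. *)
Lemma sum_last_element (d : nat) f :
  \sum_(s < d) \sum_(u <- fpowerset (coords 0 s.+1) | val s \in u) f u =
  \sum_(u <- fpowerset (coords 0 d) | u != fset0) f u.
Proof.
elim: d => [|d IH].
  rewrite big_ord0 (_ : coords 0 0 = fset0).
    by rewrite fpowerset0 big_mkcond big_seq_fset1 eqxx.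
  by apply/fsetP => j; rewrite mem_coords inE.
rewrite big_ord_recr/= IH.
rewrite big_mkcond [X in _ + X]big_mkcond [RHS]big_mkcond.
rewrite !sum_fpowerset_coordsSr//; congr (_ + _).
rewrite [X in X + _]big1_seq ?add0r => [|u /andP[_]]; last first.
  by rewrite fpowersetE => /fsubsetP us; case: ifP => // /us; rewrite (negPf (notin_coords _ _)).
apply: eq_bigr => u _; rewrite fset1U1 ifT//.
by apply/eqP => /fsetP/(_ d); rewrite fset1U1 inE.
Qed.

(** Each set is met once for each of its elements. *)
Lemma sum_card (d : nat) f :
  \sum_(s < d) \sum_(u <- fpowerset (coords 0 d) | val s \in u) f u =
  \sum_(u <- fpowerset (coords 0 d) | u != fset0) #|` u|%:R * f u.
Proof.
under eq_bigr do rewrite big_mkcond.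
rewrite exchange_big [RHS]big_mkcond big_seq [RHS]big_seq/=; apply: eq_bigr => u.
rewrite fpowersetE => us.
have -> : (\sum_(s < d) if val s \in u then f u else 0) = #|` u|%:R * f u.
  rewrite -(big_mkord xpredT (fun j => if j \in u then f u else 0)).
  by rewrite -big_mkcond big_const_seq iter_addr_0 -[LHS]mulr_natl -(count_mem_coords us).
by case: eqVneq => // ->; rewrite cardfs0 mul0r.
Qed.

Lemma cardfsU_coords (s d : nat) u w : (u `<=` coords 0 s)%fset ->
  (w `<=` coords s d)%fset -> #|` u `|` w|%fset = (#|` u| + #|` w|)%N.
Proof.
move=> /fsubsetP us /fsubsetP ws; rewrite cardfsU (_ : u `&` w = fset0)%fset.
  by rewrite cardfs0 subn0.
apply/fsetP => j; rewrite !inE; apply/negP => /andP[/us + /ws].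
by rewrite !mem_coords/= => js /andP[]; rewrite leqNgt js.
Qed.

Variables (g : {fset nat} -> R) (Z : R).
Hypotheses (g0 : forall u, 0 <= g u) (Z1 : 1 <= Z).
Let W u := g u * Z ^+ #|` u|.
Let Z0 : 0 <= Z := le_trans ler01 Z1.

Let W0 u : 0 <= W u. Proof. by rewrite mulr_ge0// exprn_ge0. Qed.

(** A second factor Z^|w| >= 1 is inserted, so that each of the two inner sums has its own and
    becomes a sum of [W (u]|[w)], called [p w] and [y w]. Then sum_w p_w y_w is at most the product
    of the sums over w, and the sets u [|] w run through all subsets once. *)
Lemma step_sum_le (s d : nat) : (s < d)%N ->
  \sum_(w <- fpowerset (coords s.+1 d)) Z ^+ #|` w| *
    ((\sum_(u <- fpowerset (coords 0 s.+1) | s \in u) g (u `|` w)%fset * Z ^+ #|` u|)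
    * (\sum_(u <- fpowerset (coords 0 s.+1)) g (u `|` w)%fset * Z ^+ #|` u|)) <=
  (\sum_(v <- fpowerset (coords 0 d) | s \in v) W v)
    * (\sum_(v <- fpowerset (coords 0 d)) W v).
Proof.
move=> sd.
pose p w := \sum_(u <- fpowerset (coords 0 s.+1) | s \in u) W (u `|` w)%fset.
pose y w := \sum_(u <- fpowerset (coords 0 s.+1)) W (u `|` w)%fset.
have p0 w : 0 <= p w by exact: sumr_ge0.
have y0 w : 0 <= y w by exact: sumr_ge0.
have Yv : \sum_(w <- fpowerset (coords s.+1 d)) y w = \sum_(v <- fpowerset (coords 0 d)) W v.
  exact: sum_fpowerset_split.
have Pv : \sum_(w <- fpowerset (coords s.+1 d)) p w =
    \sum_(v <- fpowerset (coords 0 d) | s \in v) W v.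
  rewrite [RHS]big_mkcond -(sum_fpowerset_split _ sd) big_seq [RHS]big_seq.
  apply: eq_bigr => w; rewrite fpowersetE => /fsubsetP ws.
  rewrite /p big_mkcond; apply: eq_bigr => u _; rewrite in_fsetU.
  case: (boolP (s \in w)) => [/ws|_]; last by rewrite orbF.
  by rewrite mem_coords ltnn.
rewrite -Pv -Yv big_seq mulr_suml [leRHS]big_seq; apply: ler_sum => w wd.
have yw : y w <= \sum_(w' <- fpowerset (coords s.+1 d)) y w'.
  by rewrite (bigD1_seq w)//= lerDl sumr_ge0.
apply: le_trans (ler_wpM2l (p0 w) yw).
have H (b : pred {fset nat}) : Z ^+ #|` w| *
    \sum_(u <- fpowerset (coords 0 s.+1) | b u) g (u `|` w)%fset * Z ^+ #|` u| =
    \sum_(u <- fpowerset (coords 0 s.+1) | b u) W (u `|` w)%fset.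
  rewrite mulr_sumr big_seq_cond [RHS]big_seq_cond; apply: eq_bigr => u /andP[+ _].
  rewrite !fpowersetE in wd * => us; rewrite /W (cardfsU_coords us wd) exprD; ring.
have Hy : _ = y w := H xpredT.
rewrite mulrA H -[X in _ <= _ * X]Hy; apply: ler_wpM2l; first exact: (p0 w).
rewrite ler_peMl ?exprn_ege1//; apply: sumr_ge0 => u _.
by rewrite mulr_ge0// exprn_ge0.
Qed.

(** The condition gives Z^|w| g(u [|] w) <= xi g(u), which frees the first inner sum from w; only
    subsets of the first s + 1 coordinates remain there. The second one receives a factor Z^|w| >= 1
    and, summed over w, becomes the sum over all subsets. *)
Lemma step_sum_le_xi (xi : R) (s d : nat) : (s < d)%N -> 0 <= xi ->
  (forall u w, (u `<=` coords 0 s.+1)%fset -> (w `<=` coords s.+1 d)%fset ->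
     g (u `|` w)%fset <= xi * (g u / Z ^+ #|` w|)) ->
  \sum_(w <- fpowerset (coords s.+1 d)) Z ^+ #|` w| *
    ((\sum_(u <- fpowerset (coords 0 s.+1) | s \in u) g (u `|` w)%fset * Z ^+ #|` u|)
    * (\sum_(u <- fpowerset (coords 0 s.+1)) g (u `|` w)%fset * Z ^+ #|` u|)) <=
  xi * (\sum_(u <- fpowerset (coords 0 s.+1) | s \in u) W u)
    * (\sum_(v <- fpowerset (coords 0 d)) W v).
Proof.
move=> sd xi0 gxi; rewrite -(sum_fpowerset_split W sd) [leRHS]mulr_sumr.
rewrite big_seq [leRHS]big_seq; apply: ler_sum => w wd.
have Zw : 0 < Z ^+ #|` w| by rewrite exprn_gt0// (lt_le_trans ltr01).
rewrite mulrA; apply: ler_pM.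
- by rewrite mulr_ge0 ?(ltW Zw)//; apply: sumr_ge0 => u _; rewrite mulr_ge0// exprn_ge0.
- by apply: sumr_ge0 => u _; rewrite mulr_ge0// exprn_ge0.
- rewrite !mulr_sumr big_seq_cond [leRHS]big_seq_cond; apply: ler_sum => u /andP[us _].
  rewrite !fpowersetE in us wd; rewrite /W mulrA [xi * _]mulrA; apply: ler_wpM2r.
    by rewrite exprn_ge0.
  rewrite mulrC -ler_pdivlMr// -mulrA; exact: gxi.
rewrite big_seq [leRHS]big_seq; apply: ler_sum => u us; rewrite !fpowersetE in us wd.
rewrite /W (cardfsU_coords us wd) exprD mulrA ler_peMr ?exprn_ege1//.
by rewrite mulr_ge0// exprn_ge0.
Qed.

End subset_sums.

(** * Bounds on S_d for a CBC vector *)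

Section criterion_bounds.
Context (R : realType) (alpha : R) (gamma : {fset nat} -> R).
Hypotheses (alpha_gt1 : 1 < alpha) (gamma_ge0 : forall u : {fset nat}, 0 <= gamma u).
Variables (d n : nat) (z : d.-tuple nat) (lambda : R).
Hypotheses (pn : prime n) (cbc : is_cbc alpha gamma n z)
  (l_gt : alpha^-1 < lambda) (l_le1 : lambda <= 1).
Let t := tau alpha lambda.
Let Z := 2 * zeta (alpha * lambda).

Lemma lambda_gt0 : 0 < lambda.
Proof. by apply: lt_trans l_gt; rewrite invr_gt0 (lt_trans ltr01). Qed.

Lemma alpha_lambda_gt1 : 1 < alpha * lambda.
Proof. by rewrite mulrC -ltr_pdivrMr ?div1r// (lt_trans ltr01). Qed.

Lemma zeta2_ge1 : 1 <= Z.
Proof. by have := zeta_ge1 alpha_lambda_gt1; rewrite /Z; lra. Qed.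

Lemma S_crit_powR_le :
  (S_crit alpha gamma n z `^ lambda <=
  (t / n%:R * \sum_(s < d) \sum_(w <- fpowerset (coords s.+1 d)) Z ^+ #|` w| *
    ((\sum_(u <- fpowerset (coords 0 s.+1) | val s \in u)
        gamma (u `|` w)%fset `^ lambda * Z ^+ #|` u|)
    * (\sum_(u <- fpowerset (coords 0 s.+1))
        gamma (u `|` w)%fset `^ lambda * Z ^+ #|` u|)))%:E)%E.
Proof.
have l0 := lambda_gt0; have al1 := alpha_lambda_gt1.
have l01 : 0 < lambda <= 1 by rewrite l0.
have S0 := S_crit_ge0 alpha n z gamma_ge0.
apply: le_trans (lee_poweR (ltW l0) S0 (S_crit_le n alpha_gt1 gamma_ge0 (erefl _))) _.
have T0 s zz : (0 <= T_crit alpha gamma n d s.+1 zz)%E.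
  apply: sume_ge0 => w _; rewrite mule_ge0// ?lee_fin ?exprn_ge0//.
    by rewrite mulr_ge0// (le_trans ler01)// zeta_ge1//; have := alpha_gt1; lra.
  apply: esum_ge0 => h _; apply: esum_ge0 => l _; rewrite lee_fin.
  by rewrite !mulr_ge0// rprime_decay prodr_ge0// => j _; exact: decay_ge0.
apply: le_trans (poweR_sum_le _ l01 _) _ => //.
rewrite mulr_sumr -sumEFin; apply: lee_sum => s _.
have [zs Tmin] := cbc s.
have tk : take s.+1 z = rcons (take s z) (tnth z s).
  by rewrite (tnth_nth 0%N) (take_nth 0%N) ?size_tuple.
rewrite tk in Tmin *.
have x1 : 1 < lambda * alpha by rewrite mulrC.
have t6 : 6 <= t by rewrite /t /tau le_max lexx.
(* The second entry of [tau] dominates because 2 <= 5/2 and alpha lambda <= 2 alpha lambda. *)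
have tx : 2 `^ (lambda * alpha + 1) + 2 <= t.
  rewrite /t /tau le_max; apply/orP; right; rewrite addrC; apply: lerD; first by lra.
  by rewrite ler_powR ?ler1n//; lra.
apply: le_trans (cbc_T_le pn _ l01 x1 gamma_ge0 t6 tx Tmin) _.
  by rewrite size_take size_tuple ltn_ord.
rewrite lee_fin [lambda * alpha]mulrC -/Z mulr_sumr le_eqVlt; apply/orP; left; apply/eqP.
by apply: eq_bigr => w _; ring.
Qed.

Lemma S_crit_root (X : R) : (S_crit alpha gamma n z `^ lambda <= X%:E)%E ->
  (S_crit alpha gamma n z <= (X `^ lambda^-1)%:E)%E.
Proof.
have l0 := lambda_gt0 => h.
have S0 := S_crit_ge0 alpha n z gamma_ge0.
rewrite -poweR_EFin -[leLHS]poweRe1// -(mulfV (lt0r_neq0 l0)) poweRrM.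
by apply: lee_poweR => //; rewrite ?poweR_ge0// invr_ge0 ltW.
Qed.

Lemma t_over_n_ge0 : 0 <= t / n%:R.
Proof. by rewrite divr_ge0// /t /tau le_max ler0n. Qed.

Lemma S_crit_bound :
  (S_crit alpha gamma n z <=
   ((t / n%:R
     * (\sum_(u <- fpowerset (coords 0 d) | u != fset0)
          #|` u|%:R * wterm alpha gamma lambda u)
     * (\sum_(u <- fpowerset (coords 0 d)) wterm alpha gamma lambda u))
     `^ lambda^-1)%:E)%E.
Proof.
apply: S_crit_root; apply: le_trans S_crit_powR_le _; rewrite lee_fin -[leRHS]mulrA.
apply: ler_wpM2l; first exact: t_over_n_ge0.
rewrite -sum_card mulr_suml; apply: ler_sum => s _.
apply: (step_sum_le (g := fun u => gamma u `^ lambda)) => //.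
- by move=> u; exact: powR_ge0.
- exact: zeta2_ge1.
Qed.

Lemma S_crit_bound_xi (xi : R) : 1 <= xi ->
  (forall (s d' : nat) (u w : {fset nat}),
     (1 <= s)%N -> (1 <= d')%N ->
     (u `<=` coords 0 s)%fset -> (w `<=` coords s d')%fset ->
     gamma (u `|` w)%fset `^ lambda <= xi * (gamma u `^ lambda / Z ^+ #|` w|)) ->
  (S_crit alpha gamma n z <=
   ((t * xi / n%:R
     * (\sum_(u <- fpowerset (coords 0 d) | u != fset0) wterm alpha gamma lambda u)
     * (\sum_(u <- fpowerset (coords 0 d)) wterm alpha gamma lambda u))
     `^ lambda^-1)%:E)%E.
Proof.
move=> xi1 gxi; apply: S_crit_root; apply: le_trans S_crit_powR_le _.
rewrite lee_fin [t * xi / _]mulrAC -[leRHS]mulrA -[leRHS]mulrA.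
apply: ler_wpM2l; first exact: t_over_n_ge0.
rewrite [xi * (_ * _)]mulrA -sum_last_element [X in _ <= X * _]mulr_sumr [leRHS]mulr_suml; apply: ler_sum => s _.
apply: (step_sum_le_xi (g := fun u => gamma u `^ lambda)) => //.
- by move=> u; exact: powR_ge0.
- exact: zeta2_ge1.
- exact: le_trans ler01 xi1.
- by move=> u w; apply: gxi => //; apply: leq_ltn_trans (ltn_ord s).
Qed.

End criterion_bounds.

(** * The L2 norm of a function with a Fourier series *)

Section trigonometric_integrals.
Context (R : realType).
Local Notation mR := (measurableTypeR R).

Lemma cosD_int (t : R) (m : int) : cos (t + 2 * pi * m%:~R) = cos t.
Proof.
have nat_case (n : nat) (s : R) : cos (s + 2 * pi * n%:R) = cos s.
  rewrite -[RHS](periodicn (@cosD2pi R) n); congr (cos (_ + _)).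
  by ring.
case: m => n; first exact: nat_case.
by rewrite NegzE mulrNz mulrN -[LHS](nat_case n.+1) subrK.
Qed.

Lemma sinD_int (t : R) (m : int) : sin (t + 2 * pi * m%:~R) = sin t.
Proof. by rewrite -!cosBpihalf addrAC cosD_int. Qed.

Lemma measurable_trig1 (a t : R) :
  measurable_fun [set: mR] (fun x : mR => cos (a * x + t)).
Proof.
apply: continuous_measurable_fun => x; apply: continuous_comp.
  by apply: cvgD; [apply: cvgM; [exact: cvg_cst|exact: cvg_id]|exact: cvg_cst].
exact: continuous_cos.
Qed.

Lemma integrable_cos d (T : measurableType d) (mu : probability T R)
    (g : T -> R) :
  measurable_fun [set: T] (fun x => cos (g x)) ->
  mu.-integrable [set: T] (fun x => (cos (g x))%:E).
Proof.
move=> mg; apply: measurable_bounded_integrable => //.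
  exact: le_lt_trans (probability_le1 _ measurableT) (ltry 1).
exists 1; split => // M M1 x _ /=; apply: ltW; apply: le_lt_trans M1.
by rewrite ler_norml cos_geN1 cos_le1.
Qed.

Lemma integral_lebesgue01_cos (m : int) (t : R) : m != 0 ->
  (\int[@lebesgue01 R]_x (cos (2 * pi * m%:~R * x + t))%:E = 0)%E.
Proof.
move=> m0; set a := 2 * pi * m%:~R.
have a0 : a != 0 by rewrite !mulf_neq0 ?intr_eq0// gt_eqF ?pi_gt0.
have mI : measurable (`[0%R, 1%R]%classic : set mR) by exact: measurable_itv.
(* [lebesgue01] is a measure on the whole line. The complement of [0, 1] is null for it, and on
   [0, 1] it is Lebesgue measure, for which the fundamental theorem of calculus is available; the
   primitive has equal values at 0 and 1 by periodicity. *)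
rewrite (negligible_integral (N := ~` (`[0%R, 1%R]%classic : set mR))); last 4 first.
- exact: measurableC.
- exact: measurableT.
- exact: (integrable_cos (@lebesgue01 R) (measurable_trig1 a t)).
- exact: (eq_trans (congr1 (@lebesgue_measure R) (setICl _)) (measure0 _)).
rewrite setTD setCK (@eq_measure_integral _ _ _ _ (@lebesgue_measure R)); last first.
  by move=> A mA AI; exact: (congr1 (@lebesgue_measure R) (setIidl AI)).
pose F (x : R) := a^-1 * sin (a * x + t).
have dF (x : R) : is_derive x 1 F (cos (a * x + t)).
  apply: trigger_derive => /=.
  by rewrite addr0 [a%:A]mulr1 /GRing.scale/= mulrCA mulVf// mulr1.
have cf (x : R) : {for x, continuous F}.
  by apply/differentiable_continuous; rewrite -derivable1_diffP.
rewrite (@continuous_FTC2 _ (fun x => cos (a * x + t)) F)//.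
- rewrite /F mulr0 mulr1 add0r [a + t]addrC sinD_int subee//.
- apply: continuous_subspaceT => x; apply: continuous_comp.
    by apply: cvgD; [apply: cvgM; [exact: cvg_cst|exact: cvg_id]|exact: cvg_cst].
  exact: continuous_cos.
- split.
  + by move=> x _.
  + apply: cvg_at_right_filter; exact: cf.
  + apply: cvg_at_left_filter; exact: cf.
- by move=> x _; rewrite derive1E derive_val.
Qed.

Section cube_integrals.
Variable d : nat.

Lemma measurable_trig (h : {ffun 'I_d -> int}) (t : R) :
  measurable_fun [set: d.-tuple mR] (fun x : d.-tuple mR => cos (2 * pi * dot h x + t)).
Proof.
apply: (@measurableT_comp _ _ _ _ _ _ (@cos R)) => //.
  by apply: continuous_measurable_fun; exact: continuous_cos.
apply: measurable_funD => //; apply: measurable_funM => //.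
apply: measurable_sum => j; apply: measurable_funM => //.
exact: measurable_tnth.
Qed.

Lemma integrable_trig (h : {ffun 'I_d -> int}) (t : R) :
  (cube R d).-integrable [set: d.-tuple mR]
    (fun x => (cos (2 * pi * dot h x + t))%:E).
Proof. exact: (integrable_cos (cube R d) (measurable_trig h t)). Qed.

End cube_integrals.

Lemma dot_tcons d (h : {ffun 'I_d.+1 -> int}) (p : mR * d.-tuple mR) :
  dot h (tcons p) = (h ord0)%:~R * p.1 + dot [ffun i => h (lift ord0 i)] p.2.
Proof.
rewrite /dot big_ord_recl tnth0; congr (_ + _).
by apply: eq_bigr => i _; rewrite tnthS ffunE.
Qed.

(** Fubini, in the order that makes the inner integral vanish: if h_0 = 0 the other coordinates come
    first, by induction; otherwise coordinate 0 does, the others entering only as a phase. The phase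
    t also covers sines. *)
Lemma integral_cube_cos d (h : {ffun 'I_d -> int}) (t : R) : h != 0 ->
  (\int[cube R d]_x (cos (2 * pi * dot h x + t))%:E = 0)%E.
Proof.
elim: d h t => [|d IH] h t h0.
  by case/eqP: h0; apply/ffunP => -[].
rewrite /=.
have mf : measurable_fun [set: d.+1.-tuple mR] (EFin \o (fun x : d.+1.-tuple mR => cos (2 * pi * dot h x + t))).
  by apply/measurable_EFinP; exact: measurable_trig.
have mF : measurable_fun [set: mR * d.-tuple mR]
    (fun p : mR * d.-tuple mR => cos (2 * pi * dot h (tcons p) + t)).
  apply: (@measurableT_comp _ _ _ _ _ _ (fun x : d.+1.-tuple mR => cos (2 * pi * dot h x + t)) _ (@tcons R d)) => //.
  exact: measurable_trig.
pose P : probability (mR * d.-tuple mR)%type R := (@lebesgue01 R \x cube R d)%E.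
have iF := integrable_cos P mF.
rewrite integral_distribution//.
have [h00|h00] := eqVneq (h ord0) 0.
  rewrite -integral12_prod_meas1// integral0_eq// => x _.
  rewrite /fubini_F.
  under eq_integral do rewrite /= dot_tcons h00 mul0r add0r.
  apply: IH; apply: contra h0 => /eqP/ffunP h'0; apply/eqP/ffunP => j.
  rewrite ffunE; case: (unliftP ord0 j) => [i ->|->//].
  by have := h'0 i; rewrite !ffunE.
rewrite -integral21_prod_meas1// integral0_eq// => x _.
rewrite /fubini_G.
under eq_integral do rewrite /= dot_tcons mulrDr mulrA -addrA.
exact: (integral_lebesgue01_cos (2 * pi * dot [ffun i => h (lift ord0 i)] x + t) h00).
Qed.

End trigonometric_integrals.

Section L2_bound.
Context (R : realType) (d : nat).
Local Notation point := (d.-tuple (measurableTypeR R)).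
Local Notation freq := {ffun 'I_d -> int}.
Local Notation normc := ComplexField.Normc.normc.

Lemma sqr_normc_ReIm (c : R[i]) : normc c ^+ 2 = complex.Re c ^+ 2 + complex.Im c ^+ 2.
Proof. by case: c => a b /=; rewrite sqr_sqrtr// addr_ge0 ?sqr_ge0. Qed.

Lemma Re_sum (I : Type) (r : seq I) (f : I -> R[i]) :
  complex.Re (\sum_(i <- r) f i) = \sum_(i <- r) complex.Re (f i).
Proof. by elim: r => [|i r IH]; rewrite ?big_nil// !big_cons -IH; case: (f i) (\sum_(j <- r) f j) => ? ? []. Qed.

Lemma Im_sum (I : Type) (r : seq I) (f : I -> R[i]) :
  complex.Im (\sum_(i <- r) f i) = \sum_(i <- r) complex.Im (f i).
Proof. by elim: r => [|i r IH]; rewrite ?big_nil// !big_cons -IH; case: (f i) (\sum_(j <- r) f j) => ? ? []. Qed.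

Definition trig_poly (c : freq -> R[i]) (B : seq freq) (x : point) : R[i] :=
  \sum_(h <- B) c h * expi (2 * pi * dot h x).

Lemma dotB (h k : freq) (x : point) : dot (h - k) x = dot h x - dot k x.
Proof.
by rewrite /dot -sumrB; apply: eq_bigr => j _; rewrite !ffunE intrB mulrBl.
Qed.

(** Index set of the expansion of the squared modulus of a trigonometric polynomial. The boolean
    selects the cosine or the sine of a pair, the sine being written as a cosine with phase -pi/2,
    so that all terms are real multiples of cosines. *)
Definition pairs (B : seq freq) : seq ((freq * freq) * bool) :=
  [seq (p, b) | p <- [seq (h, k) | h <- B, k <- B], b <- [:: true; false]].

Definition pair_coef (c : freq -> R[i]) (p : (freq * freq) * bool) : R :=
  let: ((h, k), b) := p in
  if b then complex.Re (c h) * complex.Re (c k) + complex.Im (c h) * complex.Im (c k)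
  else complex.Re (c h) * complex.Im (c k) - complex.Im (c h) * complex.Re (c k).

Lemma sqr_normc_trig_poly (c : freq -> R[i]) (B : seq freq) (x : point) :
  normc (trig_poly c B x) ^+ 2 = \sum_(p <- pairs B) pair_coef c p *
    cos (2 * pi * dot (p.1.1 - p.1.2) x + if p.2 then 0 else - (pi / 2)).
Proof.
rewrite sqr_normc_ReIm /trig_poly Re_sum Im_sum /pairs !big_allpairs/=.
rewrite !expr2 !big_distrlr/= -big_split; apply: eq_bigr => h _ /=.
rewrite -big_split; apply: eq_bigr => k _ /=.
rewrite big_cons big_seq1/= addr0 cosBpihalf dotB mulrBr cosB sinB.
case: (c h) (c k) => p q [p' q'] /=; ring.
Qed.

Lemma measurable_sqr_trig_poly (c : freq -> R[i]) (B : seq freq) :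
  measurable_fun [set: point] (fun x : point => normc (trig_poly c B x) ^+ 2).
Proof.
under eq_fun do rewrite sqr_normc_trig_poly.
apply: measurable_sum => p; apply: measurable_funM => //; exact: measurable_trig.
Qed.

Lemma integral_scaled_cos (a t : R) (l : freq) :
  (\int[cube R d]_x (a * cos (2 * pi * dot l x + t))%:E =
   (if l == 0%R then a * cos t else 0)%:E)%E.
Proof.
under eq_integral do rewrite EFinM.
rewrite integralZl//; last exact: integrable_trig.
case: eqVneq => [->|l0]; last by rewrite integral_cube_cos// mule0.
under eq_integral => x _.
  rewrite (_ : dot 0 x = 0); last first.
    by rewrite /dot big1// => j _; rewrite ffunE mul0r.
  rewrite mulr0 add0r; over.
by rewrite integral_cst//= probability_setT mule1.
Qed.

Lemma integral_sqr_trig_poly (c : freq -> R[i]) (B : seq freq) : uniq B ->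
  (\int[cube R d]_x (normc (trig_poly c B x) ^+ 2)%:E =
   (\sum_(h <- B) normc (c h) ^+ 2)%:E)%E.
Proof.
move=> uB.
under eq_integral do rewrite sqr_normc_trig_poly -sumEFin.
rewrite integral_sum//; last first.
  move=> p; under eq_fun do rewrite EFinM.
  by apply: integrableZl => //; exact: integrable_trig.
under eq_bigr do rewrite integral_scaled_cos.
rewrite sumEFin; congr EFin; rewrite /pairs !big_allpairs/=.
rewrite big_seq [RHS]big_seq; apply: eq_bigr => h hB.
rewrite (bigD1_seq h)//= [X in _ + X]big1_seq ?addr0 => [|k /andP[kh _]]; last first.
  rewrite big_cons big_seq1/=.
  by rewrite subr_eq0 eq_sym (negPf kh) addr0.
rewrite big_cons big_seq1/= subrr eqxx cos0 mulr1 cosN cos_pihalf mulr0 addr0.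
by rewrite sqr_normc_ReIm !expr2.
Qed.

(** Fatou's lemma needs a sequence, while [has_sum] is a limit over all finite sets. Enumerating the
    countable type of frequencies gives finite sets that eventually contain any given one. *)
Definition exhaustion (N : nat) : {fset freq} :=
  [fset h in pmap choice.unpickle (iota 0 N)]%fset.

Lemma exhaustionP (A : {fset freq}) :
  exists N0, forall N, (N0 <= N)%N -> (A `<=` exhaustion N)%fset.
Proof.
exists (\max_(h <- A) (choice.pickle h).+1)%N => N AN; apply/fsubsetP => h hA.
rewrite !inE mem_pmap; apply/mapP; exists (choice.pickle h); rewrite ?choice.pickleK//.
rewrite mem_iota/= add0n; apply: leq_trans AN.
by rewrite (big_fsetD1 h hA)/= leq_maxl.
Qed.

Lemma ler_normc_sqr (u v : R[i]) (e : R) : normc (u - v) < e -> e <= 1 ->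
  `|normc u ^+ 2 - normc v ^+ 2| <= e * (2 * normc v + 1).
Proof.
move=> uve e1.
have n0 (w : R[i]) : 0 <= normc w by case: w => a b; exact: sqrtr_ge0.
have h : `|normc u - normc v| <= normc (u - v).
  rewrite ler_norml; apply/andP; split.
    have := le_normcD (v - u) u.
    by rewrite subrK -opprB normcN; lra.
  rewrite lerBlDr; have := le_normcD (u - v) v.
  by rewrite subrK.
rewrite subr_sqr normrM; apply: ler_pM => //.
  by apply: le_trans h (ltW uve).
rewrite ger0_norm ?addr_ge0//.
have : normc u - normc v <= 1 by apply: le_trans (ler_norm _) (le_trans h (le_trans (ltW uve) e1)).
by move=> ?; lra.
Qed.

Lemma L2_norm_le (c : freq -> R[i]) (g : point -> R[i]) (K : R) : 0 <= K ->
  (forall x, has_sum (fun h => c h * expi (2 * pi * dot h x)) (g x)) ->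
  (forall A : {fset freq}, \sum_(h <- A) normc (c h) ^+ 2 <= K) ->
  (Lnorm (cube R d) 2%:E (fun x => (normc (g x))%:E) <= (K `^ 2^-1)%:E)%E.
Proof.
move=> K0 gc cK; rewrite unlock.
have n0 (w : R[i]) : 0 <= normc w by case: w => a b; exact: sqrtr_ge0.
rewrite -poweR_EFin; apply: lee_poweR; first by rewrite invr_ge0.
  by apply: integral_ge0 => x _; exact: poweR_ge0.
pose G (N : nat) (x : point) : \bar R := (normc (trig_poly c (exhaustion N) x) ^+ 2)%:E.
have GL x : limn_einf (G ^~ x) = (normc (g x) ^+ 2)%:E.
  have cG : G ^~ x @ \oo --> (normc (g x) ^+ 2)%:E.
    apply: cvg_EFin; first by near=> N.
    apply/cvgrPdist_le => e e0.
    pose m : R := 2 * normc (g x) + 1.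
    have m0 : 0 < m by rewrite /m; have := n0 (g x); lra.
    (* By [ler_normc_sqr] an error e' <= 1 in the value costs at most e' m in the squared
       modulus. *)
    pose e' := Num.min 1 (e / m).
    have e'0 : 0 < e' by rewrite lt_min ltr01 divr_gt0.
    have [A AP] := gc x e' e'0; have [N0 N0P] := exhaustionP A.
    near=> N.
    have NN : (N0 <= N)%N by near: N; exists N0.
    rewrite distrC; apply: le_trans (ler_normc_sqr (AP _ (N0P _ NN)) _) _.
      by rewrite ge_min lexx.
    by rewrite -ler_pdivlMr// ge_min lexx orbT.
  by rewrite (is_cvg_limn_einfE _) ?(cvg_lim _ cG)//; apply/cvg_ex; exists (normc (g x) ^+ 2)%:E.
rewrite (_ : (\int[cube R d]_x _)%E = (\int[cube R d]_x limn_einf (G ^~ x))%E); last first.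
  apply: eq_integral => x _; rewrite GL /= ger0_norm//.
  by rewrite powR_mulrn.
apply: le_trans (fatou _ measurableT _ _) _ => //.
- by move=> N; apply/measurable_EFinP; exact: measurable_sqr_trig_poly.
- by move=> N x _; rewrite lee_fin sqr_ge0.
(* The lower limit is the limit of the infima over tails, and each infimum is at most its first
   member. *)
rewrite limn_einf_lim; apply: lime_le; first exact: is_cvg_einfs.
apply: nearW => N; apply: (@le_trans _ _ (\int[cube R d]_x G N x)%E).
  by apply: ereal_inf_lbound; exists N => //=.
by rewrite integral_sqr_trig_poly ?fset_uniq// lee_fin.
Unshelve. all: by end_near. Qed.

End L2_bound.

(** * Aliasing and the worst case error *)

Section exponential_sums.
Context (R : realType).
Local Notation normc := ComplexField.Normc.normc.

Lemma expiD (a b : R) : expi (a + b) = expi a * expi b.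
Proof. by rewrite /expi cosD sinD; congr (_ +i* _)%C; rewrite addrC [cos a * _]mulrC. Qed.

Lemma expiD_int (t : R) (m : int) : expi (t + 2 * pi * m%:~R) = expi t.
Proof. by rewrite /expi cosD_int sinD_int. Qed.

Lemma expi0 : expi 0 = 1 :> R[i].
Proof. by rewrite /expi cos0 sin0. Qed.

Lemma expi_int (m : int) : expi (2 * pi * m%:~R) = 1 :> R[i].
Proof. by rewrite -[2 * pi * _]add0r expiD_int expi0. Qed.

Lemma expiX (t : R) (k : nat) : expi (t * k%:R) = expi t ^+ k.
Proof.
elim: k => [|k IH]; first by rewrite mulr0 expi0 expr0.
by rewrite -natr1 mulrDr mulr1 expiD IH exprSr.
Qed.

(** With r = m mod n, 0 < r < n, half the angle is s = pi r/n in (0, pi) up to whole turns, and the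
    real part is 1 - 2 sin(s)^2 < 1. *)
Lemma expi_neq1 (n : nat) (m : int) : (0 < n)%N -> ~~ (n%:Z %| m)%Z ->
  expi (2 * pi * m%:~R / n%:R) != 1 :> R[i].
Proof.
move=> n0 nm; have nR : 0 < n%:R :> R by rewrite ltr0n.
have nz : n%:Z != 0 by rewrite eqz_nat -lt0n.
pose r := (m %% n%:Z)%Z.
have r0 : 0 < r.
  rewrite lt_neqAle modz_ge0// andbT eq_sym.
  by apply: contra nm => /eqP rm; apply/dvdz_mod0P.
have rn : r < n%:Z by rewrite /r; have := ltz_pmod m (_ : 0 < n%:Z); apply; rewrite ltz_nat.
have -> : 2 * pi * m%:~R / n%:R = pi * r%:~R / n%:R + pi * r%:~R / n%:R + 2 * pi * (m %/ n%:Z)%Z%:~R :> R.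
  have nE : (n%:Z)%:~R = n%:R :> R by [].
  rewrite {1}(divz_eq m n%:Z) intrD intrM -/r nE.
  by field; exact: lt0r_neq0.
rewrite expiD_int; apply/eqP => /(congr1 (@complex.Re R)); rewrite /expi/= cosD -!expr2.
set s := pi * r%:~R / n%:R => h.
have s0 : 0 < sin s.
  apply: sin_gt0_pi; rewrite /s; apply/andP; split.
    by rewrite divr_gt0// mulr_gt0 ?pi_gt0// ltr0z.
  rewrite ltr_pdivrMr// ltr_pM2l ?pi_gt0//.
  by rewrite -[n%:R]/((n%:Z)%:~R) ltr_int.
have := cos2Dsin2 s; have : 0 < sin s ^+ 2 by rewrite exprn_gt0.
by move: h; rewrite /real_complex_def/=; lra.
Qed.

(** A geometric sum whose ratio is an n-th root of unity. *)
Lemma sum_expi (n : nat) (m : int) : (0 < n)%N ->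
  \sum_(1 <= k < n.+1) expi (2 * pi * k%:R * m%:~R / n%:R) =
  if (n%:Z %| m)%Z then n%:R else 0 :> R[i].
Proof.
move=> n0; have nR : n%:R != 0 :> R by rewrite pnatr_eq0 -lt0n.
have E (k : nat) : expi (2 * pi * k%:R * m%:~R / n%:R) = expi (2 * pi * m%:~R / n%:R) ^+ k :> R[i].
  by rewrite -expiX; congr expi; ring.
under eq_bigr do rewrite E.
set w := expi _.
have wn : w ^+ n = 1 by rewrite -expiX divfK// expi_int.
case: ifPn => [/divzK nm|nm].
  have -> : w = 1.
    have nE : (n%:Z)%:~R = n%:R :> R by [].
    rewrite /w -nm intrM nE.
    by rewrite mulrA mulfK// expi_int.
  under eq_bigr do rewrite expr1n.
  by rewrite sumr_const_nat subn1.
have w1 : w != 1 by exact: expi_neq1.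
rewrite big_add1/= big_mkord; under eq_bigr do rewrite exprS.
rewrite -mulr_sumr; have := subrX1 w n; rewrite wn subrr => /esym/eqP.
by rewrite mulf_eq0 subr_eq0 (negPf w1)/= => /eqP ->; rewrite mulr0.
Qed.

End exponential_sums.

(** * Unconditional sums of complex families *)

Section unconditional_sums.
Context (R : realType) (I : choiceType).
Implicit Types (a b : I -> R[i]) (l : R[i]).
Local Notation normc := ComplexField.Normc.normc.

Lemma normc_ge0 (w : R[i]) : 0 <= normc w.
Proof. by case: w => a b; exact: sqrtr_ge0. Qed.

Lemma has_sum_fset (A : {fset I}) a :
  (forall i, i \notin A -> a i = 0) -> has_sum a (\sum_(i <- A) a i).
Proof.
move=> a0 e e0; exists A => B AB.
rewrite (big_fset_incl _ AB) ?subrr ?ComplexField.Normc.normc0// => i _ iA.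
exact: a0.
Qed.

Lemma has_sumD a b l l' : has_sum a l -> has_sum b l' ->
  has_sum (fun i => a i + b i) (l + l').
Proof.
move=> al bl e e0; have e2 : 0 < e / 2 by rewrite divr_gt0.
have [A AP] := al _ e2; have [B BP] := bl _ e2.
exists (A `|` B)%fset => C; rewrite fsubUset => /andP[AC BC].
rewrite big_split/= opprD addrACA; apply: le_lt_trans (le_normcD _ _) _.
by rewrite [ltRHS](splitr e); apply: ltrD; [exact: AP|exact: BP].
Qed.

Lemma has_sumZ (c : R[i]) a l : has_sum a l -> has_sum (fun i => c * a i) (c * l).
Proof.
move=> al e e0; have c1 : 0 < normc c + 1 by rewrite ltr_pwDr// normc_ge0.
have [A AP] := al (e / (normc c + 1)) (divr_gt0 e0 c1).
exists A => B AB; rewrite -mulr_sumr -mulrBr ComplexField.Normc.normcM.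
apply: (@le_lt_trans _ _ ((normc c) * (e / (normc c + 1)))).
  by apply: ler_wpM2l; [exact: normc_ge0|exact/ltW/AP].
by rewrite mulrCA -[ltRHS]mulr1 ltr_pM2l// ltr_pdivrMr// mul1r ltrDl.
Qed.

Lemma has_sum_sum (J : Type) (r : seq J) (a : J -> I -> R[i]) (l : J -> R[i]) :
  (forall j, has_sum (a j) (l j)) ->
  has_sum (fun i => \sum_(j <- r) a j i) (\sum_(j <- r) l j).
Proof.
move=> al; elim: r => [|j r IH].
  rewrite big_nil (_ : (fun _ => _) = fun=> 0); last by apply/funext => i; rewrite big_nil.
  have := @has_sum_fset fset0 (fun=> 0); rewrite big_seq_fset0; exact.
rewrite big_cons (_ : (fun _ => _) = fun i => a j i + \sum_(j <- r) a j i).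
  exact: has_sumD.
by apply/funext => i; rewrite big_cons.
Qed.

Lemma has_sum_normc_le a l (K : R) : has_sum a l ->
  (forall A : {fset I}, normc (\sum_(i <- A) a i) ^+ 2 <= K) -> normc l ^+ 2 <= K.
Proof.
move=> al aK; have K0 : 0 <= K by apply: le_trans (aK fset0); exact: sqr_ge0.
rewrite -(sqr_sqrtr K0) ler_pXn2r ?nnegrE ?normc_ge0 ?sqrtr_ge0//.
apply/ler_addgt0Pl => e e0; have [A AP] := al e e0.
have := AP A (fsubset_refl A); have := aK A.
rewrite -[X in _ <= X -> _](sqr_sqrtr K0) ler_pXn2r ?nnegrE ?normc_ge0 ?sqrtr_ge0// => AK Ae.
have := le_normcD (l - \sum_(i <- A) a i) (\sum_(i <- A) a i).
by rewrite subrK -opprB normcN; lra.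
Qed.

(* Cauchy-Schwarz, in the form 2 x_i x_j <= y_i r_j + y_j r_i. *)
Lemma sqr_sum_le (s : seq I) (x y r : I -> R) :
  (forall i, 0 <= x i) -> (forall i, 0 <= y i) -> (forall i, 0 <= r i) ->
  (forall i, x i ^+ 2 = y i * r i) ->
  (\sum_(i <- s) x i) ^+ 2 <= (\sum_(i <- s) y i) * (\sum_(i <- s) r i).
Proof.
move=> x0 y0 r0 xyr; rewrite expr2 !big_distrlr/= -(ler_pM2l (x := 2))// !mulr_natl !mulr2n.
rewrite [X in _ <= _ + X]exchange_big -big_split -big_split/=.
apply: ler_sum => i _; rewrite -!big_split; apply: ler_sum => j _ /=.
have := sqr_ge0 (x i * x j); rewrite -mulr2n -mulr_natl.
rewrite -(ler_pXn2r (n := 2))// ?nnegrE ?addr_ge0 ?mulr_ge0//.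
have -> : (2 * (x i * x j)) ^+ 2 = 4 * ((y i * r j) * (y j * r i)).
  by rewrite !exprMn !xyr; ring.
by have := sqr_ge0 (y i * r j - y j * r i); nra.
Qed.

End unconditional_sums.

(** * Error of the lattice algorithm *)

Section error_bound.
Context (R : realType) (alpha : R) (gamma : {fset nat} -> R).
Hypotheses (alpha_gt1 : 1 < alpha) (gamma_ge0 : forall u : {fset nat}, 0 <= gamma u).
Context (d n : nat) (z : d.-tuple nat).
Hypothesis n_gt0 : (0 < n)%N.
Local Notation point := (d.-tuple (measurableTypeR R)).
Local Notation freq := {ffun 'I_d -> int}.
Local Notation normc := ComplexField.Normc.normc.

(** Taking fractional parts changes the phase by 2 pi times an integer, since h has integer
    entries. *)
Lemma expi_dot_lattice (h : freq) (k : nat) :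
  expi (2 * pi * dot h (lattice_point R n z k)) =
  expi (2 * pi * k%:R * (\sum_(j < d) h j * (tnth z j)%:Z)%:~R / n%:R).
Proof.
pose v j : R := (k * tnth z j)%:R / n%:R.
pose q : int := \sum_(j < d) h j * Num.floor (v j).
rewrite -[LHS](expiD_int _ q); congr expi.
rewrite -mulrDr.
have -> : dot h (lattice_point R n z k) + q%:~R = \sum_(j < d) (h j)%:~R * v j.
  rewrite /dot /q rmorph_sum/= -big_split; apply: eq_bigr => j _/=.
  by rewrite intrM -mulrDr tnth_mktuple /fracpart -/(v j) subrK.
rewrite rmorph_sum/= -!mulrA; congr (_ * (_ * _)).
rewrite mulr_suml mulr_sumr; apply: eq_bigr => j _.
rewrite /v intrM natrM; have -> : ((tnth z j)%:Z)%:~R = (tnth z j)%:R :> R by [].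
by ring.
Qed.

(** The aliasing formula: the Fourier series is inserted at each of the n nodes, and the average of
    the exponentials over the nodes keeps exactly the k with k - h dual. The series has to represent
    f at the nodes themselves, hence pointwise. *)
Lemma lattice_coef_has_sum (f : point -> R) (h : freq) :
  (forall x, has_sum (fun h => fourier f h * expi (2 * pi * dot h x)) (f x)%:C%C) ->
  has_sum (fun k : freq => if dualb n z (k - h) then fourier f k else 0)
    (lattice_coef n z f h).
Proof.
move=> fS; pose zh : R := \sum_(j < d) (h j)%:~R * (tnth z j)%:R.
have coefE : lattice_coef n z f h = n%:R^-1 * \sum_(1 <= k < n.+1)
    expi (- (2 * pi * k%:R * zh / n%:R)) * (f (lattice_point R n z k))%:C%C.
  by rewrite /lattice_coef; congr (_ * _); apply: eq_bigr => k _; rewrite mulrC.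
have := has_sumZ (n%:R^-1 : R[i]) (has_sum_sum (index_iota 1 n.+1)
  (fun k => has_sumZ (expi (- (2 * pi * k%:R * zh / n%:R))) (fS (lattice_point R n z k)))).
rewrite -coefE; congr has_sum; apply/funext => k.
have zhE : zh = (\sum_(j < d) h j * (tnth z j)%:Z)%:~R.
  by rewrite rmorph_sum/=; apply: eq_bigr => j _; rewrite intrM.
under eq_bigr => i _.
  rewrite expi_dot_lattice mulrCA -expiD.
  rewrite (_ : _ + _ = 2 * pi * i%:R * (\sum_(j < d) (k - h) j * (tnth z j)%:Z)%:~R / n%:R); last first.
    rewrite zhE (_ : \sum_(j < d) (k - h) j * (tnth z j)%:Z =
      \sum_(j < d) k j * (tnth z j)%:Z - \sum_(j < d) h j * (tnth z j)%:Z).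
      by rewrite intrB; ring.
    by rewrite -sumrB; apply: eq_bigr => j _; rewrite !ffunE mulrBl.
  over.
rewrite -mulr_sumr sum_expi// mulrCA /dualb.
under [in RHS]eq_bigr do rewrite -tnth_nth.
case: ifP => _; last by rewrite !mulr0.
by rewrite mulVf ?mulr1// pnatr_eq0 -lt0n.
Qed.

Local Notation rho := (amp alpha gamma).

Lemma rho_ge0 (h : freq) : 0 <= rho h.
Proof. exact: amp_ge0. Qed.

Lemma index_setE (M : R) (h : freq) : 0 < M ->
  index_set alpha gamma M h <-> M^-1 <= rho h.
Proof.
move=> M0; rewrite /index_set/= rfunE inver; have := rho_ge0 h.
have [r0|r0 rge] := eqVneq (rho h) 0.
  rewrite r0 leye_eq/= => _; split=> //.
  by rewrite leNgt invr_gt0 M0.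
have rp : 0 < rho h by rewrite lt_neqAle eq_sym r0.
by rewrite lee_fin -[X in _ <= X](invrK M) lef_pV2 ?posrE ?invr_gt0.
Qed.

(** [lattice_alg] uses a finitely supported sum, which needs this to be the intended one. If [G]
    bounds the weights, 1/M <= 1/r(h) <= G |h_j|^(-alpha) for h_j != 0, so |h_j|^alpha <= M G. *)
Lemma index_set_finite (M : R) : 0 < M -> finite_set (index_set alpha gamma M : set freq).
Proof.
move=> M0; pose G := \sum_(u <- fpowerset (coords 0 d)) gamma u.
have a0 : 0 < alpha by exact: lt_trans alpha_gt1.
have gG (h : freq) : gamma (supp h) <= G.
  rewrite /G (bigD1_seq (supp h)) ?fset_uniq//= ?lerDl ?sumr_ge0//.
  by rewrite fpowersetE supp_coords.
pose N := Num.Def.archi_bound ((M * G) `^ alpha^-1).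
have bnd (h : freq) : index_set alpha gamma M h -> forall j, (`|h j| <= N)%N.
  move=> /(index_setE _ M0) hM j; have [->//|hj] := eqVneq (h j) 0.
  have hj1 (i : 'I_d) : decay alpha (h i) <= 1.
    have [->|hi] := eqVneq (h i) 0; first by rewrite /decay eqxx.
    apply: le_trans (decay_le (ltW a0) ltr01 _) _; last by rewrite powR1.
    by rewrite -intr_norm ler1z -gtz0_ge1 normr_gt0.
  have dj : M^-1 <= G * decay alpha (h j).
    apply: le_trans hM _; apply: ler_pM => //.
      by apply: prodr_ge0 => i _; exact: decay_ge0.
    rewrite (bigD1 j)//= ler_piMr ?decay_ge0//.
    by rewrite prodr_ile1// => i; rewrite decay_ge0 hj1.
  rewrite decay_neq0// powRN in dj.
  have hp : 0 < `|(h j)%:~R| `^ alpha :> R by rewrite powR_gt0// normr_gt0 intr_eq0.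
  have hMG : `|(h j)%:~R| `^ alpha <= M * G.
    by move: dj; rewrite ler_pdivlMr// mulrC ler_pdivrMr// mulrC.
  have : `|(h j)%:~R| <= (M * G) `^ alpha^-1 :> R.
    have -> : `|(h j)%:~R| = (`|(h j)%:~R| `^ alpha) `^ alpha^-1 :> R.
      by rewrite -powRrM mulfV ?lt0r_neq0// powRr1.
    apply: ge0_ler_powR; rewrite ?nnegrE ?powR_ge0 ?invr_ge0 ?(ltW a0)//.
    by rewrite (le_trans (ltW hp)).
  rewrite -intr_norm -natr_absz => /le_lt_trans hN.
  have /hN : (M * G) `^ alpha^-1 < N%:R by rewrite archi_boundP// powR_ge0.
  by rewrite ltr_nat => /ltnW.
pose F : {fset int} := [fset m in [seq i%:Z - N%:Z | i <- index_iota 0 (N + N).+1]]%fset.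
apply: (@sub_finite_set _ _ (range (@fext d F))); last exact/finite_image/finite_finset.
move=> h /bnd hN.
have hF j : h j \in F.
  rewrite in_fset; apply/mapP; have hj := hN j.
  have h0 : 0 <= h j + N%:Z.
    have : `|h j| <= N%:Z by rewrite -abszE lez_nat.
    by rewrite ler_norml -subr_ge0 opprK => /andP[].
  have hi : (`|(h j + N%:Z)%R| < (N + N).+1)%N.
    rewrite ltnS; apply: (@leq_trans (`|h j| + N)); last by rewrite leq_add2r.
    by rewrite -lez_nat PoszD !abszE; apply: le_trans (ler_normD _ _) _.
  by exists `|(h j + N%:Z)%R|%N; rewrite ?mem_index_iota// gez0_abs// addrK.
exists [ffun j => [` hF j]%fset] => //.
by apply/ffunP => j; rewrite !ffunE.
Qed.

Section one_function.
Variables (f : point -> R).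
Hypotheses (fS : forall x, has_sum (fun h => fourier f h * expi (2 * pi * dot h x)) (f x)%:C%C)
  (f1 : (korobov_norm alpha gamma f <= 1)%E).
(** The term |f^_h|^2 r(h) of the squared norm as a real number. Division by 0 gives 0 where r(h) =
    +oo; this agrees with the norm, whose finiteness forces f^_h = 0 there ([yE]). *)
Let y (h : freq) : R := normc (fourier f h) ^+ 2 / rho h.

Let y_ge0 h : 0 <= y h.
Proof. by rewrite divr_ge0 ?sqr_ge0 ?rho_ge0. Qed.

Let esum_le1 : (\esum_(h in [set: freq]) ((normc (fourier f h) ^+ 2)%:E * rfun alpha gamma h) <= 1)%E.
Proof.
have r0 (h : freq) : (0 <= rfun alpha gamma h)%E by rewrite rfunE inve_ge0 lee_fin rho_ge0.
set E := (X in (X <= _)%E).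
have E0 : (0 <= E)%E by apply: esum_ge0 => h _; rewrite mule_ge0// lee_fin sqr_ge0.
have := lee_poweR (ler0n R 2) (poweR_ge0 _ _) f1.
by rewrite poweR1r -poweRrM mulVf// poweRe1.
Qed.

Let term_le (h : freq) : ((normc (fourier f h) ^+ 2)%:E * rfun alpha gamma h <= 1)%E.
Proof.
apply: le_trans esum_le1.
have := @sum_le_esum R _ [set: freq] [:: h] (fun h => (normc (fourier f h) ^+ 2)%:E * rfun alpha gamma h)%E.
by rewrite big_seq1; apply.
Qed.

Let yE h : normc (fourier f h) ^+ 2 = y h * rho h.
Proof.
rewrite /y; have [r0|r0] := eqVneq (rho h) 0; last by rewrite divfK.
rewrite r0 mulr0; have := term_le h; rewrite rfunE r0 inve0.
have [->//|x0] := eqVneq (normc (fourier f h) ^+ 2) 0.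
by rewrite gt0_muley ?lte_fin ?lt_neqAle ?sqr_ge0 ?[0 == _]eq_sym ?x0// leye_eq.
Qed.

Let y_sum (A : {fset freq}) : \sum_(h <- A) y h <= 1.
Proof.
rewrite -lee_fin; apply: le_trans esum_le1.
apply: (@le_trans _ _ (\sum_(h <- A) (normc (fourier f h) ^+ 2)%:E * rfun alpha gamma h)%E); last first.
  by apply: sum_le_esum => //; exact: fset_uniq.
rewrite -sumEFin; apply: lee_sum => h _; rewrite rfunE /y.
have [r0|r0] := eqVneq (rho h) 0.
  by rewrite r0 invr0 mulr0 inve0 mule_ge0 ?lee_fin ?sqr_ge0.
by rewrite inver (negPf r0) -EFinM.
Qed.

Let W (h : freq) : \bar R := (\esum_(l in [set l | l != 0%R /\ dual_lattice n z l])
  (rfun alpha gamma (h + l)%R)^-1)%E.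

Let alias_le (h : freq) :
  ((normc (lattice_coef n z f h - fourier f h) ^+ 2)%:E <= W h)%E.
Proof.
pose a (k : freq) : R[i] := if (k != h) && dualb n z (k - h) then fourier f k else 0.
have aS : has_sum a (lattice_coef n z f h - fourier f h).
  (* The term k = h of the aliasing formula is present because 0 is dual; it cancels
     [fourier f h]. *)
  have := has_sumD (lattice_coef_has_sum h fS)
     (has_sum_fset (A := [fset h]%fset) (a := fun k => if k == h then - fourier f h else 0) _).
  rewrite big_seq_fset1 eqxx (_ : (fun _ => _ + _) = a).
    by apply=> k; rewrite inE => /negPf ->.
  apply/funext => k; rewrite /a; case: eqVneq => [->|_] /=; last by rewrite addr0.
  by rewrite subrr /dualb big1 ?dvdz0 ?subrr// => j _; rewrite ffunE mul0r.
have fin (A : {fset freq}) : ((normc (\sum_(k <- A) a k) ^+ 2)%:E <= W h)%E.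
  pose P (k : freq) := (k != h) && dualb n z (k - h).
  pose B := [fset k in A | P k]%fset.
  have -> : \sum_(k <- A) a k = \sum_(k <- B) fourier f k.
    by rewrite /a -big_mkcond -[RHS]big_fset_condE.
  apply: (@le_trans _ _ (\sum_(k <- B) rho k)%:E).
    rewrite lee_fin; apply: (@le_trans _ _ ((\sum_(k <- B) normc (fourier f k)) ^+ 2)).
      rewrite ler_pXn2r ?nnegrE ?normc_ge0 ?sumr_ge0// => [|k _]; last exact: normc_ge0.
      elim/big_ind2 : _ => [|u p v q pu qv|//]; first by rewrite ComplexField.Normc.normc0.
      by apply: le_trans (le_normcD _ _) _; exact: lerD.
    have := @sqr_sum_le R freq B (fun k => normc (fourier f k)) y (fun k => rho k)
      (fun k => normc_ge0 _) y_ge0 rho_ge0 yE.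
    move/le_trans; apply; rewrite ler_piMl ?y_sum//.
    by apply: sumr_ge0 => k _; exact: rho_ge0.
  rewrite -sumEFin (_ : \sum_(k <- B) _ = \sum_(l <- [seq (k - h)%R | k <- B]) (rfun alpha gamma (h + l)%R)^-1)%E.
    apply: sum_le_esum; first by rewrite map_inj_uniq ?fset_uniq//; exact: addIr.
    move=> l /mapP[k]; rewrite !inE => /andP[kA /andP[kh dk]] ->; split.
      by rewrite subr_eq0.
    exact: dk.
  by rewrite big_map; apply: eq_bigr => k _; rewrite addrC subrK rfunV.
case: (W h) fin => [w| |] fin; last 2 first.
- by rewrite leey.
- by have := fin fset0.
by rewrite lee_fin; apply: (has_sum_normc_le aS) => A; rewrite -lee_fin.
Qed.

Lemma L2_error_le (M : R) : 0 < M ->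
  (Lnorm (cube R d) 2%:E
     (fun x => (normc ((f x)%:C%C - lattice_alg alpha gamma n M z f x))%:E) <=
   ((M^-1)%:E + M%:E * S_crit alpha gamma n z) `^ 2^-1)%E.
Proof.
move=> M0; set S := S_crit alpha gamma n z.
have S0 : (0 <= S)%E := S_crit_ge0 alpha n z gamma_ge0.
have fin_idx := index_set_finite M0.
pose X := fset_set (index_set alpha gamma M : set freq).
have XE h : (h \in X) = (M^-1 <= rho h).
  rewrite in_fset_set//; apply/idP/idP; first by move/set_mem/(index_setE _ M0).
  by move=> ?; apply/mem_set/index_setE.
(* The Fourier coefficients of f - A(f). *)
pose c (h : freq) : R[i] := fourier f h - if h \in X then lattice_coef n z f h else 0.
have cS x : has_sum (fun h => c h * expi (2 * pi * dot h x))
    ((f x)%:C%C - lattice_alg alpha gamma n M z f x).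
  have := has_sumD (fS x) (has_sum_fset (A := X) (a := fun h =>
    - (if h \in X then lattice_coef n z f h else 0) * expi (2 * pi * dot h x)) _).
  rewrite (_ : (fun _ => _ + _) = fun h => c h * expi (2 * pi * dot h x)); last first.
    by apply/funext => h; rewrite -mulrDl.
  rewrite /lattice_alg fsbig_finite//= -/X.
  rewrite [X in _ -> has_sum _ (_ - X)](_ : _ =
     - \sum_(h <- X) - (if h \in X then lattice_coef n z f h else 0) * expi (2 * pi * dot h x)).
    by rewrite opprK; apply => h /negPf ->; rewrite oppr0 mul0r.
  rewrite -sumrN big_seq [RHS]big_seq; apply: eq_bigr => h ->.
  by rewrite mulNr opprK.
have Mh (h : freq) : h \in X -> 1 <= M * rho h.
  by rewrite XE => h1; rewrite -(mulfV (lt0r_neq0 M0)) ler_pM2l.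
have cB (A : {fset freq}) : ((\sum_(h <- A) normc (c h) ^+ 2)%:E <= (M^-1)%:E + M%:E * S)%E.
  (* Outside [X] the sum is at most M^-1 times the sum of [y]; inside, each term is at most M rho(h)
     W(h), a part of M S. *)
  rewrite (bigID (fun h => h \in X))/= addrC EFinD; apply: leeD.
    rewrite lee_fin -[leRHS]mulr1; apply: (@le_trans _ _ (M^-1 * \sum_(h <- A) y h)).
      rewrite mulr_sumr [leRHS](bigID (fun h => h \in X))/= -[leLHS]add0r; apply: lerD.
        by apply: sumr_ge0 => h _; rewrite mulr_ge0// invr_ge0 ltW.
      apply: ler_sum => h hX; rewrite /c (negPf hX) subr0 yE mulrC ler_wpM2r//.
      by apply: ltW; rewrite ltNge -XE.
    by apply: ler_wpM2l; rewrite ?invr_ge0 ?(ltW M0)//.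
  rewrite big_fset_condE/=; set B := [fset h in A | h \in X]%fset.
  rewrite -sumEFin.
  apply: (@le_trans _ _ (M%:E * \sum_(h <- B) ((rfun alpha gamma h)^-1 * W h))%E); last first.
    apply: lee_wpmul2l; first by rewrite lee_fin ltW.
    by apply: sum_le_esum => //; exact: fset_uniq.
  have W0 h : (0 <= W h)%E by apply: le_trans (alias_le h); rewrite lee_fin sqr_ge0.
  rewrite ge0_sume_distrr; last by move=> h _; rewrite rfunV mule_ge0 ?lee_fin ?rho_ge0.
  rewrite big_seq [leRHS]big_seq; apply: lee_sum => h; rewrite !inE => /andP[_ hX].
  rewrite /c hX -opprB normcN; apply: le_trans (alias_le h) _.
  rewrite rfunV muleA -EFinM -[leLHS]mul1e; apply: lee_wpmul2r => //.
  by rewrite lee_fin Mh.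
(* If S_d is infinite the bound is trivial; otherwise it is a real number, as [L2_norm_le]
   requires. *)
case ES : S S0 cB => [s| |] S0 cB //; last first.
  by rewrite gt0_muley ?lte_fin// addey// poweRyr ?leey// invr_eq0.
rewrite -EFinM -EFinD poweR_EFin; apply: (L2_norm_le _ cS) => [|A].
  by rewrite addr_ge0 ?invr_ge0 ?(ltW M0)// mulr_ge0// ltW.
by rewrite -lee_fin EFinD EFinM; exact: cB.
Qed.

End one_function.

Lemma wor_app_le (M : R) : 0 < M ->
  (wor_app alpha gamma n M z <=
   ((M^-1)%:E + M%:E * S_crit alpha gamma n z) `^ 2^-1)%E.
Proof.
move=> M0; apply: ge_ereal_sup => _ [f [[_ _ _ fS _] f1] <-].
exact: L2_error_le.
Qed.

End error_bound.

(** * Choice of M and convergence rates *)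

Section rates.
Context (R : realType) (alpha : R) (gamma : {fset nat} -> R).
Hypotheses (alpha_gt1 : 1 < alpha) (gamma_ge0 : forall u : {fset nat}, 0 <= gamma u)
  (gamma_set0 : gamma fset0 = 1).
Variable lambda : R.
Hypotheses (l_gt : alpha^-1 < lambda) (l_le1 : lambda <= 1).
Implicit Types (u : {fset nat}) (d n : nat).

Lemma tau_ge1 : 1 <= tau alpha lambda.
Proof. by rewrite /tau le_max ler1n. Qed.

Lemma wterm_ge0 u : 0 <= wterm alpha gamma lambda u.
Proof.
rewrite mulr_ge0 ?powR_ge0// exprn_ge0//.
exact: le_trans ler01 (zeta2_ge1 alpha_gt1 l_gt).
Qed.

Lemma wterm_fset0 : wterm alpha gamma lambda fset0 = 1.
Proof. by rewrite /wterm gamma_set0 powR1 cardfs0 expr0 mulr1. Qed.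

Lemma fset0_in_fpowerset d : fset0 \in fpowerset (coords 0 d).
Proof. by rewrite fpowersetE fsub0set. Qed.

Lemma sum_wterm_ge1 d :
  1 <= \sum_(u <- fpowerset (coords 0 d)) wterm alpha gamma lambda u.
Proof.
rewrite (bigD1_seq fset0) ?fset0_in_fpowerset ?fset_uniq//= wterm_fset0 lerDl.
by apply: sumr_ge0 => u _; exact: wterm_ge0.
Qed.

Lemma sum_wterm_le_max d :
  \sum_(u <- fpowerset (coords 0 d)) wterm alpha gamma lambda u <=
  \sum_(u <- fpowerset (coords 0 d)) (maxn #|` u| 1)%:R * wterm alpha gamma lambda u.
Proof.
apply: ler_sum => u _; rewrite ler_peMl ?wterm_ge0// ler1n.
by rewrite leq_max orbT.
Qed.

Lemma sum_card_wterm_le_max d :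
  \sum_(u <- fpowerset (coords 0 d) | u != fset0) #|` u|%:R * wterm alpha gamma lambda u <=
  \sum_(u <- fpowerset (coords 0 d)) (maxn #|` u| 1)%:R * wterm alpha gamma lambda u.
Proof.
rewrite big_mkcond; apply: ler_sum => u _; case: ifP => _.
  by rewrite ler_wpM2r ?wterm_ge0// ler_nat leq_maxl.
by rewrite mulr_ge0// wterm_ge0.
Qed.

Lemma sum_wterm_neq0_le d :
  \sum_(u <- fpowerset (coords 0 d) | u != fset0) wterm alpha gamma lambda u <=
  \sum_(u <- fpowerset (coords 0 d)) wterm alpha gamma lambda u.
Proof.
by rewrite big_mkcond; apply: ler_sum => u _; case: ifP => // _; exact: wterm_ge0.
Qed.

(** Both summands under the root are at most V = n^(-1/(2 lambda)) t^(1/lambda) W^(2/lambda): the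
    first because t, W >= 1, the second by monotonicity. The right-hand side is the square root of 2
    V. *)
Lemma balanced_bound (n : nat) (t X Y W : R) : (0 < n)%N -> 1 <= t ->
  0 <= X <= W -> 0 <= Y <= W -> 1 <= W ->
  ((n%:R `^ (2 * lambda)^-1)^-1 +
     n%:R `^ (2 * lambda)^-1 * (t / n%:R * X * Y) `^ lambda^-1) `^ 2^-1 <=
  Num.sqrt 2 * t `^ (2 * lambda)^-1 / n%:R `^ (4 * lambda)^-1 * W `^ lambda^-1.
Proof.
move=> n0 t1 /andP[X0 XW] /andP[Y0 YW] W1.
have l0 : 0 < lambda := lambda_gt0 alpha_gt1 l_gt.
have nR : 0 < n%:R :> R by rewrite ltr0n.
have t0 : 0 <= t := le_trans ler01 t1.
have W0 : 0 <= W := le_trans ler01 W1.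
have n0' : 0 <= n%:R^-1 :> R by rewrite invr_ge0 ltW.
set a := lambda^-1.
have a0 : 0 < a by rewrite invr_gt0.
have e2 : (2 * lambda)^-1 = a * 2^-1 by rewrite invfM mulrC.
have e4 : (4 * lambda)^-1 = a * 2^-1 * 2^-1 by rewrite /a; field; exact: lt0r_neq0.
rewrite e2 e4; set N := n%:R `^ (a * 2^-1).
have N0 : 0 < N by exact: powR_gt0.
have Na : n%:R `^ a = N * N.
  by rewrite /N -powRD ?(gt_eqF nR) ?implybT// -splitr.
have powR_ge1 (b : R) : 1 <= b -> 1 <= b `^ a.
  by move=> b1; rewrite -[leLHS](powRr0 b) ler_powR// ltW.
have ta1 := powR_ge1 _ t1; have Wa1 := powR_ge1 _ W1.
pose V := N^-1 * t `^ a * (W `^ a) ^+ 2.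
have h1 : N^-1 <= V.
  rewrite /V -mulrA ler_peMr ?invr_ge0 ?(ltW N0)//.
  by rewrite mulr_ege1// exprn_ege1.
have h2 : N * (t / n%:R * X * Y) `^ a <= V.
  apply: (@le_trans _ _ (N * (t / n%:R * W * W) `^ a)).
    apply: ler_wpM2l; first exact: ltW.
    apply: ge0_ler_powR; rewrite ?nnegrE ?(ltW a0) ?mulr_ge0//.
    by apply: ler_pM; rewrite ?mulr_ge0//; apply: ler_wpM2l; rewrite ?mulr_ge0.
  rewrite !powRM ?mulr_ge0// -powR_inv1 ?(ltW nR)// -powRrM mulN1r powRN Na /V.
  rewrite le_eqVlt; apply/orP; left; apply/eqP; field.
  by rewrite lt0r_neq0.
have V0 : 0 <= V by apply: le_trans h1; rewrite invr_ge0 ltW.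
apply: (@le_trans _ _ ((2 * V) `^ 2^-1)).
  apply: ge0_ler_powR; rewrite ?nnegrE ?invr_ge0//.
  - by rewrite addr_ge0 ?invr_ge0 ?mulr_ge0 ?powR_ge0 ?(ltW N0).
  - by rewrite mulr_ge0.
  - by rewrite mulr_natl mulr2n; exact: lerD.
have NV0 : 0 <= N^-1 by rewrite invr_ge0 ltW.
rewrite powRM// powR12_sqrt// /V.
rewrite (powRM _ (mulr_ge0 NV0 (powR_ge0 t a)) (sqr_ge0 (W `^ a))).
rewrite (powRM _ NV0 (powR_ge0 t a)).
have -> : ((W `^ a) ^+ 2) `^ 2^-1 = W `^ a.
  by rewrite -powR_mulrn ?powR_ge0// -powRrM mulfV// powRr1 ?powR_ge0.
have -> : N^-1 `^ 2^-1 = (n%:R `^ (a / 2 / 2))^-1.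
  by rewrite -powR_inv1 ?(ltW N0)// -powRrM mulN1r powRN /N -powRrM.
rewrite -(powRrM t) le_eqVlt; apply/orP; left; apply/eqP.
by ring.
Qed.

(** Shared by both theorems on weights: [X] and [Y] are the two sums in the bound on S_d and [W] a
    common majorant, with the factor xi absorbed in [t] when the additional condition holds. *)
Lemma error_at_balanced_M d n (z : d.-tuple nat) (t X Y W : R) : (0 < n)%N -> 1 <= t ->
  0 <= X <= W -> 0 <= Y <= W -> 1 <= W ->
  (S_crit alpha gamma n z <= ((t / n%:R * X * Y) `^ lambda^-1)%:E)%E ->
  (forall M : R, 0 < M ->
    (wor_app alpha gamma n M z <=
       ((M^-1)%:E + M%:E * S_crit alpha gamma n z) `^ 2^-1)%E /\
    (((M^-1)%:E + M%:E * S_crit alpha gamma n z) `^ 2^-1 <=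
       ((M^-1 + M * (t / n%:R * X * Y) `^ lambda^-1) `^ 2^-1)%:E)%E) /\
  (wor_app alpha gamma n (n%:R `^ (2 * lambda)^-1) z <=
     (Num.sqrt 2 * t `^ (2 * lambda)^-1 / n%:R `^ (4 * lambda)^-1 * W `^ lambda^-1)%:E)%E.
Proof.
move=> n0 t1 XW YW W1 SB.
have H (M : R) : 0 < M -> (wor_app alpha gamma n M z <=
       ((M^-1)%:E + M%:E * S_crit alpha gamma n z) `^ 2^-1)%E /\
    (((M^-1)%:E + M%:E * S_crit alpha gamma n z) `^ 2^-1 <=
       ((M^-1 + M * (t / n%:R * X * Y) `^ lambda^-1) `^ 2^-1)%:E)%E.
  move=> M0; split; first exact: wor_app_le.
  have S0 := S_crit_ge0 alpha n z gamma_ge0.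
  rewrite -poweR_EFin; apply: lee_poweR; first by rewrite invr_ge0.
    by rewrite adde_ge0 ?mule_ge0 ?lee_fin ?invr_ge0 ?(ltW M0).
  by rewrite EFinD EFinM leeD2l// lee_wpmul2l// lee_fin ltW.
split=> //; have M0 : 0 < n%:R `^ (2 * lambda)^-1 :> R by rewrite powR_gt0 ?ltr0n.
have [h1 h2] := H _ M0; apply: le_trans h1 (le_trans h2 _).
by rewrite lee_fin balanced_bound.
Qed.

Lemma error_bounds d n (z : d.-tuple nat) : prime n -> is_cbc alpha gamma n z ->
  (forall M : R, 0 < M ->
     (wor_app alpha gamma n M z <=
        ((M^-1)%:E + M%:E * S_crit alpha gamma n z) `^ 2^-1)%E /\
     (((M^-1)%:E + M%:E * S_crit alpha gamma n z) `^ 2^-1 <=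
        ((M^-1 + M *
           (tau alpha lambda / n%:R
            * (\sum_(u <- fpowerset (coords 0 d) | u != fset0)
                 #|` u|%:R * wterm alpha gamma lambda u)
            * (\sum_(u <- fpowerset (coords 0 d))
                 wterm alpha gamma lambda u)) `^ lambda^-1)
         `^ 2^-1)%:E)%E) /\
  (wor_app alpha gamma n (n%:R `^ (2 * lambda)^-1) z <=
     (Num.sqrt 2 * tau alpha lambda `^ (2 * lambda)^-1
        / n%:R `^ (4 * lambda)^-1
      * (\sum_(u <- fpowerset (coords 0 d))
           (maxn #|` u| 1)%:R * wterm alpha gamma lambda u)
        `^ lambda^-1)%:E)%E.
Proof.
move=> pn cbc; apply: error_at_balanced_M; first exact: prime_gt0.
- exact: tau_ge1.
- rewrite sum_card_wterm_le_max andbT sumr_ge0// => u _.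
  by rewrite mulr_ge0// wterm_ge0.
- by rewrite sum_wterm_le_max andbT (le_trans ler01)// sum_wterm_ge1.
- by rewrite (le_trans (sum_wterm_ge1 d))// sum_wterm_le_max.
- exact: S_crit_bound.
Qed.

Lemma error_bounds_xi (xi : R) : 1 <= xi ->
  (forall (s d' : nat) (u w : {fset nat}),
     (1 <= s)%N -> (1 <= d')%N ->
     (u `<=` coords 0 s)%fset -> (w `<=` coords s d')%fset ->
     gamma (u `|` w)%fset `^ lambda <=
       xi * (gamma u `^ lambda / (2 * zeta (alpha * lambda)) ^+ #|` w|)) ->
  forall d n (z : d.-tuple nat), prime n -> is_cbc alpha gamma n z ->
  (forall M : R, 0 < M ->
     (wor_app alpha gamma n M z <=
        ((M^-1)%:E + M%:E * S_crit alpha gamma n z) `^ 2^-1)%E /\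
     (((M^-1)%:E + M%:E * S_crit alpha gamma n z) `^ 2^-1 <=
        ((M^-1 + M *
           (tau alpha lambda * xi / n%:R
            * (\sum_(u <- fpowerset (coords 0 d) | u != fset0)
                 wterm alpha gamma lambda u)
            * (\sum_(u <- fpowerset (coords 0 d))
                 wterm alpha gamma lambda u)) `^ lambda^-1)
         `^ 2^-1)%:E)%E) /\
  (wor_app alpha gamma n (n%:R `^ (2 * lambda)^-1) z <=
     (Num.sqrt 2 * (tau alpha lambda * xi) `^ (2 * lambda)^-1
        / n%:R `^ (4 * lambda)^-1
      * (\sum_(u <- fpowerset (coords 0 d))
           wterm alpha gamma lambda u) `^ lambda^-1)%:E)%E.
Proof.
move=> xi1 gxi d n z pn cbc; apply: error_at_balanced_M; first exact: prime_gt0.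
- by rewrite mulr_ege1// tau_ge1.
- rewrite sum_wterm_neq0_le andbT sumr_ge0// => u _; exact: wterm_ge0.
- by rewrite lexx andbT (le_trans ler01)// sum_wterm_ge1.
- exact: sum_wterm_ge1.
- exact: S_crit_bound_xi.
Qed.

Lemma rate_exponent n (delta : R) : lambda = (alpha - 4 * delta)^-1 ->
  (n%:R `^ (4 * lambda)^-1)^-1 = n%:R `^ (- alpha / 4 + delta) :> R.
Proof.
move=> ->; rewrite -powRN; congr (_ `^ _).
by rewrite invfM invrK; field.
Qed.

(* Applied with t = tau, f u = max(|u|, 1) wterm u, and with t = tau * xi, f = wterm. *)
Lemma convergence_rates (t delta : R) (f : {fset nat} -> R) :
  1 <= t -> lambda = (alpha - 4 * delta)^-1 ->
  (forall u, 0 <= f u) -> f fset0 = 1 ->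
  (forall d n (z : d.-tuple nat), prime n -> is_cbc alpha gamma n z ->
     (wor_app alpha gamma n (n%:R `^ (2 * lambda)^-1) z <=
       (Num.sqrt 2 * t `^ (2 * lambda)^-1 / n%:R `^ (4 * lambda)^-1
        * (\sum_(u <- fpowerset (coords 0 d)) f u) `^ lambda^-1)%:E)%E) ->
  (forall d : nat, (1 <= d)%N ->
     exists2 C : R, 0 < C &
       forall (n : nat) (z : d.-tuple nat),
         prime n -> is_cbc alpha gamma n z ->
         (wor_app alpha gamma n (n%:R `^ (2 * lambda)^-1) z <=
            (C * n%:R `^ (- alpha / 4 + delta))%:E)%E) /\
  ((\esum_(u in [set: {fset nat}]) (f u)%:E < +oo)%E ->
     exists2 C : R, 0 < C &
       forall (d n : nat) (z : d.-tuple nat),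
         (1 <= d)%N -> prime n -> is_cbc alpha gamma n z ->
         (wor_app alpha gamma n (n%:R `^ (2 * lambda)^-1) z <=
            (C * n%:R `^ (- alpha / 4 + delta))%:E)%E).
Proof.
move=> t1 lE f0 f01 H; pose c := Num.sqrt 2 * t `^ (2 * lambda)^-1.
have c0 : 0 < c by rewrite mulr_gt0 ?sqrtr_gt0 ?powR_gt0// (lt_le_trans ltr01).
have sum1 d : 1 <= \sum_(u <- fpowerset (coords 0 d)) f u.
  by rewrite (bigD1_seq fset0) ?fset0_in_fpowerset ?fset_uniq//= f01 lerDl sumr_ge0.
have main (d : nat) (W : R) : \sum_(u <- fpowerset (coords 0 d)) f u <= W ->
    forall n (z : d.-tuple nat), prime n -> is_cbc alpha gamma n z ->
    (wor_app alpha gamma n (n%:R `^ (2 * lambda)^-1) z <=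
      (c * W `^ lambda^-1 * n%:R `^ (- alpha / 4 + delta))%:E)%E.
  move=> dW n z pn cbc; apply: le_trans (H d n z pn cbc) _.
  rewrite lee_fin (rate_exponent n lE) -/c mulrAC ler_wpM2r ?powR_ge0// ler_wpM2l ?(ltW c0)//.
  have s0 : 0 <= \sum_(u <- fpowerset (coords 0 d)) f u by exact: le_trans (sum1 d).
  apply: ge0_ler_powR; rewrite ?nnegrE//; last exact: le_trans dW.
  by rewrite invr_ge0 ltW// (lambda_gt0 alpha_gt1 l_gt).
split=> [d _|esum_fin].
  exists (c * (\sum_(u <- fpowerset (coords 0 d)) f u) `^ lambda^-1).
    by rewrite mulr_gt0// powR_gt0// (lt_le_trans ltr01).
  by move=> n z; apply: main.
set E := (\esum_(u in _) _)%E in esum_fin.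
(* The sum over all finite sets of indices dominates the sum for each d, so one constant serves
   every dimension. *)
have dE d : ((\sum_(u <- fpowerset (coords 0 d)) f u)%:E <= E)%E.
  by rewrite -sumEFin; apply: sum_le_esum => //; exact: fset_uniq.
case: E esum_fin dE => [W| |]//; last by move=> _ /(_ 0%N); rewrite leeNy_eq.
move=> _ dW; exists (c * W `^ lambda^-1); last first.
  by move=> d n z _; apply: main; rewrite -lee_fin.
rewrite mulr_gt0// powR_gt0// (lt_le_trans ltr01)//.
by apply: le_trans (sum1 0%N) _; rewrite -lee_fin.
Qed.

End rates.

Theorem theorem3p6 (R : realType) (alpha : R) (gamma : {fset nat} -> R)
    (alpha_gt1 : 1 < alpha)
    (gamma_ge0 : forall u : {fset nat}, 0 <= gamma u)
    (gamma_set0 : gamma fset0 = 1) :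
  (* error bounds for general weights *)
  (forall (d n : nat) (z : d.-tuple nat) (lambda : R),
     (1 <= d)%N -> prime n -> is_cbc alpha gamma n z ->
     alpha^-1 < lambda -> lambda <= 1 ->
     (forall M : R, 0 < M ->
        (wor_app alpha gamma n M z <=
           ((M^-1)%:E + M%:E * S_crit alpha gamma n z) `^ 2^-1)%E /\
        (((M^-1)%:E + M%:E * S_crit alpha gamma n z) `^ 2^-1 <=
           ((M^-1 + M *
              (tau alpha lambda / n%:R
               * (\sum_(u <- fpowerset (coords 0 d) | u != fset0)
                    #|` u|%:R * wterm alpha gamma lambda u)
               * (\sum_(u <- fpowerset (coords 0 d))
                    wterm alpha gamma lambda u)) `^ lambda^-1)
            `^ 2^-1)%:E)%E) /\
     (wor_app alpha gamma n (n%:R `^ (2 * lambda)^-1) z <=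
        (Num.sqrt 2 * tau alpha lambda `^ (2 * lambda)^-1
           / n%:R `^ (4 * lambda)^-1
         * (\sum_(u <- fpowerset (coords 0 d))
              (maxn #|` u| 1)%:R * wterm alpha gamma lambda u)
           `^ lambda^-1)%:E)%E) /\
  (* convergence rate for general weights *)
  (forall delta lambda : R,
     0 < delta -> lambda = (alpha - 4 * delta)^-1 ->
     alpha^-1 < lambda -> lambda <= 1 ->
     (forall d : nat, (1 <= d)%N ->
        exists2 C : R, 0 < C &
          forall (n : nat) (z : d.-tuple nat),
            prime n -> is_cbc alpha gamma n z ->
            (wor_app alpha gamma n (n%:R `^ (2 * lambda)^-1) z <=
               (C * n%:R `^ (- alpha / 4 + delta))%:E)%E) /\
     ((\esum_(u in [set: {fset nat}])
         ((maxn #|` u| 1)%:R * wterm alpha gamma lambda u)%:E < +oo)%E ->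
        exists2 C : R, 0 < C &
          forall (d n : nat) (z : d.-tuple nat),
            (1 <= d)%N -> prime n -> is_cbc alpha gamma n z ->
            (wor_app alpha gamma n (n%:R `^ (2 * lambda)^-1) z <=
               (C * n%:R `^ (- alpha / 4 + delta))%:E)%E)) /\
  (* improved bounds and rate under an additional condition on the weights *)
  (forall lambda xi : R,
     alpha^-1 < lambda -> lambda <= 1 -> 1 <= xi ->
     (forall (s d' : nat) (u w : {fset nat}),
        (1 <= s)%N -> (1 <= d')%N ->
        (u `<=` coords 0 s)%fset -> (w `<=` coords s d')%fset ->
        gamma (u `|` w)%fset `^ lambda <=
          xi * (gamma u `^ lambda / (2 * zeta (alpha * lambda)) ^+ #|` w|)) ->
     (forall (d n : nat) (z : d.-tuple nat),
        (1 <= d)%N -> prime n -> is_cbc alpha gamma n z ->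
        (forall M : R, 0 < M ->
           (wor_app alpha gamma n M z <=
              ((M^-1)%:E + M%:E * S_crit alpha gamma n z) `^ 2^-1)%E /\
           (((M^-1)%:E + M%:E * S_crit alpha gamma n z) `^ 2^-1 <=
              ((M^-1 + M *
                 (tau alpha lambda * xi / n%:R
                  * (\sum_(u <- fpowerset (coords 0 d) | u != fset0)
                       wterm alpha gamma lambda u)
                  * (\sum_(u <- fpowerset (coords 0 d))
                       wterm alpha gamma lambda u)) `^ lambda^-1)
               `^ 2^-1)%:E)%E) /\
        (wor_app alpha gamma n (n%:R `^ (2 * lambda)^-1) z <=
           (Num.sqrt 2 * (tau alpha lambda * xi) `^ (2 * lambda)^-1
              / n%:R `^ (4 * lambda)^-1
            * (\sum_(u <- fpowerset (coords 0 d))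
                 wterm alpha gamma lambda u) `^ lambda^-1)%:E)%E) /\
     (forall delta : R, 0 < delta -> lambda = (alpha - 4 * delta)^-1 ->
        (forall d : nat, (1 <= d)%N ->
           exists2 C : R, 0 < C &
             forall (n : nat) (z : d.-tuple nat),
               prime n -> is_cbc alpha gamma n z ->
               (wor_app alpha gamma n (n%:R `^ (2 * lambda)^-1) z <=
                  (C * n%:R `^ (- alpha / 4 + delta))%:E)%E) /\
        ((\esum_(u in [set: {fset nat}]) (wterm alpha gamma lambda u)%:E
            < +oo)%E ->
           exists2 C : R, 0 < C &
             forall (d n : nat) (z : d.-tuple nat),
               (1 <= d)%N -> prime n -> is_cbc alpha gamma n z ->
               (wor_app alpha gamma n (n%:R `^ (2 * lambda)^-1) z <=
                  (C * n%:R `^ (- alpha / 4 + delta))%:E)%E))).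
Proof.
split=> [d n z lambda _ pn cbc l_gt l_le1|].
  exact: error_bounds.
split=> [delta lambda _ lE l_gt l_le1|lambda xi l_gt l_le1 xi1 gxi].
  apply: (convergence_rates (t := tau alpha lambda) (f := fun u =>
    (maxn #|` u| 1)%:R * wterm alpha gamma lambda u) alpha_gt1 l_gt) => //.
  - exact: tau_ge1.
  - by move=> u; rewrite mulr_ge0// wterm_ge0.
  - by rewrite cardfs0 mul1r wterm_fset0.
  - by move=> d n z pn cbc; have [] := error_bounds alpha_gt1 gamma_ge0 gamma_set0 l_gt l_le1 pn cbc.
have bnds := error_bounds_xi alpha_gt1 gamma_ge0 gamma_set0 l_gt l_le1 xi1 gxi.
split=> [d n z _ pn cbc|delta _ lE]; first exact: bnds.
apply: (convergence_rates (t := tau alpha lambda * xi)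
  (f := wterm alpha gamma lambda) alpha_gt1 l_gt) => //.
- by rewrite mulr_ege1// tau_ge1.
- by move=> u; exact: wterm_ge0.
- exact: wterm_fset0.
- by move=> d n z pn cbc; have [] := bnds d n z pn cbc.
Qed.
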